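(* Consider the multi-community preferential attachment model with types described in the context. Let $\Gamma$ be the directed graph with vertex set $S$ which has an edge from $i$ to $j$ if and only if $\alpha_{j,i}>0$. Assume that $\Gamma$ is such that for any two vertices $i$ and $j$ there is a vertex $h$ such that there are directed paths in $\Gamma$ from both $i$ and $j$ to $h$ (where $h=i$ or $h=j$ is allowed, and any vertex is treated as having a directed path to itself). Then in the linear model, with $p_k=\frac km$ for all $0\le k\le m$, there exists a random variable $M$ such that, almost surely, $Z^{(t)}_i\to M$ as $t\to\infty$ for all $i\in S$.
   Context: Model. $S=\{1,\dots,N\}$ is a finite set of communities, $m\ge 1$ is an integer, $\mu=(\mu_i)_{i\in S}$ is a probability distribution on $S$ with $\mu_i>0$ for all $i$, and $A=(\alpha_{x,y})_{x,y\in S}$ (the attractiveness matrix) has non-negative entries with $\sum_x\alpha_{x,y}>0$ for every $y$. The type assignment rule is given by $p_0,\dots,p_m\in[0,1]$. $G_0$ is a fixed finite initial (multi)graph with $n_0$ vertices and $mn_0$ edges, all vertices having positive degree; each vertex $v$ has a community $c(v)\in S$ and a type (colour), red or blue, and each community contains at least one vertex of $G_0$. Given $G_t$, the graph $G_{t+1}$ is obtained by adding a vertex $v_{t+1}$ whose community $c(v_{t+1})$ has law $\mu$, independently of everything else, and $m$ edges from $v_{t+1}$ to $m$ existing vertices chosen independently with replacement, each choice being equal to vertex $v$ with probability $$\frac{\alpha_{c(v),c(v_{t+1})}\deg_{G_t}(v)}{\sum_{u\in V(G_t)}\alpha_{c(u),c(v_{t+1})}\deg_{G_t}(u)}.$$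 Then, conditional on exactly $k$ of the $m$ chosen neighbours (with multiplicity) being red, $v_{t+1}$ becomes red with probability $p_k$ and otherwise blue; types never change afterwards. $Z^{(t)}_i=\dfrac{\sum_{v\text{ red},\,c(v)=i}\deg_{G_t}(v)}{\sum_{v:\,c(v)=i}\deg_{G_t}(v)}$ is the proportion of edge-ends in community $i$ at time $t$ which are at red vertices. *)

(* Defs.v *)
From HB Require Import structures.
From mathcomp Require Import all_boot all_order all_algebra.
From mathcomp Require Import all_classical all_reals all_analysis.

Set Implicit Arguments.
Unset Strict Implicit.
Unset Printing Implicit Defensive.

Import Order.TTheory GRing.Theory Num.Theory.
Import numFieldNormedType.Exports.

Local Open Scope classical_set_scope.
Local Open Scope ring_scope.

(** Multigraphs on the vertex set ['I_n], with a community in ['I_N] and a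
    colour for each vertex.  An edge is stored as the pair of its two ends, in
    an arbitrary order; loops and repeated edges are allowed. *)
Record cgraph (N n : nat) := CGraph {
  comm : 'I_n -> 'I_N;
  red : 'I_n -> bool;
  edges : seq ('I_n * 'I_n) }.

(** The number of edge-ends at [v]: a loop contributes 2. *)
Definition deg N n (g : cgraph N n) (v : 'I_n) : nat :=
  (\sum_(e <- edges g) ((e.1 == v) + (e.2 == v)))%N.

(** What is drawn when a vertex joins a graph on ['I_n]: its community, the [m]
    chosen neighbours in order and with repetitions, and whether it is red. *)
Definition arrival (N m n : nat) : Type := ('I_N * m.-tuple 'I_n * bool)%type.

Definition acomm N m n (x : arrival N m n) : 'I_N := x.1.1.
Definition anbrs N m n (x : arrival N m n) : m.-tuple 'I_n := x.1.2.
Definition ared N m n (x : arrival N m n) : bool := x.2.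

(** The new vertex is [ord_max : 'I_n.+1]; an old vertex [v : 'I_n] becomes
    [lift ord_max v], which has the same value as a natural number. *)
Definition add_vertex N m n (g : cgraph N n) (x : arrival N m n) :
    cgraph N n.+1 :=
  CGraph
    (fun v => if unlift ord_max v is Some u then comm g u else acomm x)
    (fun v => if unlift ord_max v is Some u then red g u else ared x)
    ([seq (lift ord_max e.1, lift ord_max e.2) | e <- edges g]
     ++ [seq (ord_max, lift ord_max u) | u <- anbrs x]).

(** [history N m n0] is a trajectory: the entry of index [t] describes the
    vertex [v_{t+1}], which joins the graph [G_t] on [t + n0] vertices. *)
Definition history (N m n0 : nat) : Type := forall t : nat, arrival N m (t + n0).

Fixpoint graph_at N m n0 (G0 : cgraph N n0) (h : history N m n0) (t : nat) :
    cgraph N (t + n0) :=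
  match t with
  | 0%N => G0
  | s.+1 => add_vertex (graph_at G0 h s) (h s)
  end.

(** Probability that a given choice of a newcomer of community [c] is [v]. *)
Definition attach_prob (R : realType) N n (A : 'M[R]_N) (g : cgraph N n)
    (c : 'I_N) (v : 'I_n) : R :=
  A (comm g v) c * (deg g v)%:R
  / \sum_(u < n) A (comm g u) c * (deg g u)%:R.

Definition red_count N m n (g : cgraph N n) (w : m.-tuple 'I_n) : nat :=
  count (red g) w.

(** [Z_i] of the graph [g]. *)
Definition red_prop (R : realType) N n (g : cgraph N n) (i : 'I_N) : R :=
  (\sum_(v < n | red g v && (comm g v == i)) deg g v)%N%:R
  / (\sum_(v < n | comm g v == i) deg g v)%N%:R.

Definition past (T : Type) N m n0 (X : forall t, T -> arrival N m (t + n0))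
    (h : history N m n0) (t : nat) : set T :=
  [set x | forall s, (s < t)%N -> X s x = h s].

(** The arrivals [X] follow the dynamics of the model started from [G0].  The
    conditional laws are written in product form, [P (E `&` F) = P E * q] for
    "[F] has conditional probability [q] given [E]".  Conditioning on all
    previous arrivals is conditioning on the labelled graph [G_t], which they
    determine and which determines them. *)
Record pa_process (d : measure_display) (T : measurableType d) (R : realType)
    (P : probability T R) (N m n0 : nat) (mu : 'I_N -> R) (A : 'M[R]_N)
    (p : nat -> R) (G0 : cgraph N n0)
    (X : forall t, T -> arrival N m (t + n0)) : Prop := PAProcess {
  pa_measurable : forall t (a : arrival N m (t + n0)),
    measurable [set x | X t x = a];
  pa_community : forall (h : history N m n0) t (c : 'I_N),
    P (past X h t `&` [set x | acomm (X t x) = c])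
    = (P (past X h t) * (mu c)%:E)%E;
  pa_neighbours : forall (h : history N m n0) t (c : 'I_N)
      (w : m.-tuple 'I_(t + n0)),
    P (past X h t `&` [set x | acomm (X t x) = c]
                  `&` [set x | anbrs (X t x) = w])
    = (P (past X h t `&` [set x | acomm (X t x) = c])
       * (\prod_(j < m) attach_prob A (graph_at G0 h t) c (tnth w j))%:E)%E;
  pa_type : forall (h : history N m n0) t (c : 'I_N)
      (w : m.-tuple 'I_(t + n0)),
    P (past X h t `&` [set x | acomm (X t x) = c]
                  `&` [set x | anbrs (X t x) = w]
                  `&` [set x | ared (X t x)])
    = (P (past X h t `&` [set x | acomm (X t x) = c]
                     `&` [set x | anbrs (X t x) = w])
       * (p (red_count (graph_at G0 h t) w))%:E)%E }.

(** The directed graph Gamma: an edge from [i] to [j] iff [A j i > 0]. *)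
Definition Gamma (R : realType) N (A : 'M[R]_N) : rel 'I_N :=
  fun i j => 0 < A j i.

(* Main.v *)
Require Import Defs.
From HB Require Import structures.
From mathcomp Require Import all_boot all_order all_algebra.
From mathcomp Require Import all_classical all_reals all_analysis.
From mathcomp Require Import ring lra zify.

Set Implicit Arguments.
Unset Strict Implicit.
Unset Printing Implicit Defensive.

Import Order.TTheory GRing.Theory Num.Theory.
Import numFieldNormedType.Exports.

Local Open Scope classical_set_scope.
Local Open Scope ring_scope.

(** Write D_i for the total degree of community i, so that Z_i is the red share
    of D_i.  A newcomer of community c has, in the linear model, the mean colour
    of its chosen neighbours, and a chosen neighbour in community i is red with
    conditional probability Z_i, so its new edge-end leaves Z_i unchanged on
    average.  So only newcomers of community i push Z_i, and to first order the
    mean change of Z_i in one step is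
      (m mu_i / D_i) * sum_j q_ij (Z_j - Z_i),
    where q_ij is the probability that a neighbour chosen by a newcomer of
    community i lies in community j ([red_gain_mean], [red_prop_increment]).
    Since D_i grows linearly, Z averages along the edges of Gamma at speed 1/t,
    perturbed by martingale increments of size O(1/t).

    Such an averaging reaches consensus.  Confluence yields a vertex v that every
    vertex reaches ([confluent_sink]).  If y dominates its own averages, then
    min y is nondecreasing, hence convergent when y is bounded above; and an
    excess of y_v over min y spreads along paths to all vertices while time grows
    by a bounded factor, raising min y by a fixed proportion of that excess.
    Hence y_v - min y tends to 0 ([super_cvg]).  A summable error is absorbed by
    subtracting its tail.  Applied to Z and to -Z, this squeezes all Z_i between
    two sequences with the limit of Z_v ([consensus_cvg]).

    The perturbation becomes summable after cutting time at the fifth powers.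
    Block k, from k^5 to (k+1)^5, has about k^4 steps, each moving the
    proportions by O(k^-5).  So the averaging weights of a block are of order
    1/k, and freezing Z during the block costs only O(k^-2) ([block_average]).
    The martingale part of the block has variance O(k^4 * k^-10) = O(k^-6), so by
    Chebyshev it exceeds k^-2 with probability O(k^-2).  The exponent 5 leaves
    room for both of these bounds to be summable.  The number of newcomers of
    community i before k^5 is controlled in the same way, and gives
    D_i >= const * k^5.  By Borel-Cantelli almost every history has only finitely
    many irregular blocks ([ae_eventually_regular]); for each such history the
    consensus lemma applies ([block_cvg]).

    Every quantity at time t is a function of finitely many choices from finite
    types, so conditional expectations are finite sums ([mean_from]), tied to the
    probability by [same_past_mean]. *)

(** * Consensus of slow averaging on a directed graph *)

Lemma confluent_sink (T : finType) (e : rel T) (s : seq T) (x0 : T) :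
  (forall i j, exists h, connect e i h /\ connect e j h) ->
  exists h, forall i, i \in s -> connect e i h.
Proof.
move=> conf; elim: s => [|i s [h IH]]; first by exists x0.
have [h' [hh' ih']] := conf h i.
exists h' => j; rewrite inE => /predU1P[->//|/IH jh].
exact: connect_trans jh hh'.
Qed.

Lemma ler_div_nat (R : realType) (x : R) (k l : nat) : 0 <= x -> (0 < k <= l)%N ->
  x / l%:R <= x / k%:R.
Proof.
move=> x0 /andP[k0 kl]; rewrite ler_wpM2l// lef_pV2 ?posrE ?ltr0n ?ler_nat//.
exact: leq_trans kl.
Qed.

Section consensus.
Variables (R : realType) (N : nat) (e : rel 'I_N) (w : nat -> 'I_N -> 'I_N -> R).
Variables (C c : R) (K : nat).
Hypothesis w_ge0 : forall k i j, (K <= k)%N -> 0 <= w k i j.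
Hypothesis w_le : forall k i, (K <= k)%N -> \sum_j w k i j <= C / k%:R.
Hypothesis w_ge : forall k i j, (K <= k)%N -> e i j -> c / k%:R <= w k i j.
Hypothesis c_gt0 : 0 < c.

(** A family [y] that dominates its own averages: [y k.+1 i] is at least a convex
    combination of the [y k j].  Every window below goes from [k] to [k + k %/ q];
    there the weights [C / k] add up to at most [1/2]. *)
Section superharmonic.
Variable y : nat -> 'I_N -> R.
Hypothesis y_super : forall k i, (K <= k)%N ->
  y k i + \sum_j w k i j * (y k j - y k i) <= y k.+1 i.

Variable q : nat.
Hypothesis q_gt0 : (0 < q)%N.
Hypothesis C_ge0 : 0 <= C.
Hypothesis q_ge : 2 * C <= q%:R.
Hypothesis qK : (q <= K)%N.

Lemma super_step_ge k i B : (K <= k)%N -> (forall l, B <= y k l) ->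
  (1 - C / k%:R) * (y k i - B) <= y k.+1 i - B.
Proof.
move=> Kk HB; have := y_super i Kk.
have H : \sum_j w k i j * (B - y k i) <= \sum_j w k i j * (y k j - y k i).
  by apply: ler_sum => l _; apply: ler_wpM2l; [exact: w_ge0|rewrite lerD2r].
rewrite -mulr_suml in H.
have : 0 <= y k i - B by rewrite subr_ge0.
move=> y0; have := ler_wpM2r y0 (w_le i Kk).
lra.
Qed.

Lemma super_step_edge k i j B : (K <= k)%N -> e i j -> (forall l, B <= y k l) ->
  (1 - C / k%:R) * (y k i - B) + c / k%:R * (y k j - B) <= y k.+1 i - B.
Proof.
move=> Kk eij HB; have := y_super i Kk.
have H : \sum_j w k i j * (B - y k i) + w k i j * (y k j - B)
    <= \sum_j w k i j * (y k j - y k i).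
  rewrite (bigD1 j)//= [leRHS](bigD1 j)//= addrAC -mulrDr.
  have -> : B - y k i + (y k j - B) = y k j - y k i by ring.
  rewrite lerD2l; apply: ler_sum => l _.
  by apply: ler_wpM2l; [exact: w_ge0|rewrite lerD2r].
rewrite -mulr_suml in H.
have y0 : 0 <= y k i - B by rewrite subr_ge0.
have y1 : 0 <= y k j - B by rewrite subr_ge0.
have := ler_wpM2r y0 (w_le i Kk).
have := ler_wpM2r y1 (w_ge Kk eij).
lra.
Qed.

Lemma C_over_le_half k : (K <= k)%N -> C / k%:R <= 2^-1.
Proof.
move=> Kk; have k0 : (0 < k)%N by lia.
rewrite ler_pdivrMr ?ltr0n//.
have : q%:R <= k%:R :> R by rewrite ler_nat; lia.
by have := q_ge; lra.
Qed.

Lemma super_bound k B t : (K <= k)%N -> (forall l, B <= y k l) ->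
  forall l, B <= y (k + t)%N l.
Proof.
move=> Kk HB; elim: t => [|t IH] l; first by rewrite addn0.
rewrite addnS -subr_ge0.
apply: le_trans (super_step_ge l _ IH); last lia.
rewrite mulr_ge0 ?subr_ge0//.
by have := C_over_le_half (leq_trans Kk (leq_addr t k)); lra.
Qed.

(** A vertex loses at most a fraction [C / k] of its excess over a lower bound at
    each of the [k %/ q <= k / (2 C)] steps of a window. *)
Lemma super_hold k i B t : (K <= k)%N -> (forall l, B <= y k l) ->
  (t <= k %/ q)%N -> 2^-1 * (y k i - B) <= y (k + t)%N i - B.
Proof.
move=> Kk HB tk; have k0 : (0 < k)%N by lia.
have kR0 : 0 < k%:R :> R by rewrite ltr0n.
have y0 : 0 <= y k i - B by rewrite subr_ge0.
have main s : (1 - s%:R * (C / k%:R)) * (y k i - B) <= y (k + s)%N i - B.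
  elim: s => [|s IH]; first by rewrite mul0r subr0 mul1r addn0.
  have Ks : (K <= k + s)%N := leq_trans Kk (leq_addr s k).
  rewrite addnS; apply: le_trans (super_step_ge i Ks (super_bound s Kk HB)).
  have C1 := C_over_le_half Ks; have C2 := C_over_le_half Kk.
  have C3 : C / (k + s)%:R <= C / k%:R.
    by rewrite ler_div_nat// k0 leq_addr.
  have C4 : 0 <= C / k%:R by rewrite divr_ge0// ltW.
  have ys : 0 <= y (k + s)%N i - B by rewrite subr_ge0 super_bound.
  have s0 : 0 <= s%:R :> R by [].
  rewrite -natr1.
  apply: (@le_trans _ _ ((1 - C / k%:R) * (y (k + s)%N i - B))); last first.
    by rewrite ler_wpM2r// lerD2l lerN2.
  apply: (@le_trans _ _ ((1 - C / k%:R) * ((1 - s%:R * (C / k%:R)) * (y k i - B)))).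
    rewrite [leRHS]mulrA ler_wpM2r//.
    have := mulr_ge0 s0 (mulr_ge0 C4 C4); lra.
  by rewrite ler_wpM2l//; lra.
apply: le_trans (main t); rewrite ler_wpM2r//.
have q0 : 0 < q%:R :> R by rewrite ltr0n.
have tq : t%:R * q%:R <= k%:R :> R.
  rewrite -natrM ler_nat; apply: leq_trans (leq_trunc_div k q).
  by rewrite leq_mul2r tk orbT.
 rewrite mulrA; suff : t%:R * C / k%:R <= 2^-1 by lra.
rewrite ler_pdivrMr//.
have : 0 <= t%:R * (q%:R - 2 * C) by rewrite mulr_ge0// subr_ge0.
lra.
Qed.

(** During the window [j] keeps half of its excess, and [i] collects a fraction
    at least [c / (2 k)] of that half at each step; the losses of [i] do not undo
    this because its own excess is still small compared with the gain. *)
Lemma super_gain k i j B : (K <= k)%N -> e i j -> (forall l, B <= y k l) ->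
  c / (16 * q%:R) * (y k j - B) <= y (k + k %/ q)%N i - B.
Proof.
move=> Kk eij HB; have k0 : (0 < k)%N by lia.
have kR0 : 0 < k%:R :> R by rewrite ltr0n.
have q0 : 0 < q%:R :> R by rewrite ltr0n.
have g0 : 0 <= y k j - B by rewrite subr_ge0.
set g := y k j - B in g0 *.
have Ck : C <= k%:R / 2 by have := C_over_le_half Kk; rewrite ler_pdivrMr//; lra.
have main s : (s <= k %/ q)%N ->
    s%:R * (c / (8 * k%:R)) * g <= y (k + s)%N i - B.
  elim: s => [|s IH] sk; first by rewrite !mul0r addn0 subr_ge0.
  have {}IH := IH (ltnW sk).
  have Ks : (K <= k + s)%N := leq_trans Kk (leq_addr s k).
  rewrite addnS.
  apply: le_trans (super_step_edge Ks eij (super_bound s Kk HB)).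
  have hj := super_hold j Kk HB (ltnW sk); rewrite -/g in hj.
  have C1 := C_over_le_half Ks; have C2 := C_over_le_half Kk.
  have C3 : C / (k + s)%:R <= C / k%:R.
    by rewrite ler_div_nat// k0 leq_addr.
  have sq : s%:R * C / k%:R <= 2^-1.
    rewrite ler_pdivrMr//.
    have : s%:R * q%:R <= k%:R :> R.
      rewrite -natrM ler_nat; apply: leq_trans (leq_trunc_div k q).
      by rewrite leq_mul2r (ltnW sk) orbT.
    have : 0 <= s%:R * (q%:R - 2 * C) by rewrite mulr_ge0// subr_ge0.
    lra.
  have c3 : c / (2 * k%:R) <= c / (k + s)%:R.
    rewrite -natrM ler_div_nat ?ltW//; rewrite addn_gt0 k0/= mul2n -addnn leq_add2l.
    exact: leq_trans (ltnW sk) (leq_div k q).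
  (* With [eta] an eighth of [c / k], losing at most [eta * g / 2] and gaining
     [2 * eta * g] per step leaves a net gain of at least [eta * g]. *)
  set eta := c / (8 * k%:R) in IH *.
  have eta0 : 0 < eta by rewrite divr_gt0// mulr_gt0.
  have etaE : c / (2 * k%:R) = 4 * eta by rewrite /eta; field; rewrite lt0r_neq0.
  rewrite etaE in c3; clearbody eta.
  have h1 : (1 - C / k%:R) * (s%:R * eta * g)
      <= (1 - C / (k + s)%:R) * (y (k + s)%N i - B).
    apply: (@le_trans _ _ ((1 - C / k%:R) * (y (k + s)%N i - B))).
      by rewrite ler_wpM2l//; lra.
    rewrite ler_wpM2r ?subr_ge0 ?super_bound//; lra.
  have h2 : 4 * eta * (2^-1 * g) <= c / (k + s)%:R * (y (k + s)%N j - B).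
    by apply: ler_pM => //; rewrite mulr_ge0// ?ltW// invr_ge0.
  apply: le_trans (lerD h1 h2).
  have : s%:R * C / k%:R * (eta * g) <= 2^-1 * (eta * g).
    by rewrite ler_wpM2r// mulr_ge0// ltW.
  have : 0 <= eta * g by rewrite mulr_ge0// ltW.
  rewrite -[s.+1%:R]natr1; lra.
apply: le_trans (main _ (leqnn _)); rewrite ler_wpM2r//.
have kq : k%:R <= 2 * q%:R * (k %/ q)%:R :> R.
  rewrite -!natrM ler_nat.
  have := divn_eq k q; have := ltn_pmod k q_gt0.
  have : (0 < k %/ q)%N by rewrite divn_gt0//; lia.
  nia.
rewrite mulrA ler_pdivlMr ?mulr_gt0// mulrAC ler_pdivrMr ?mulr_gt0//.
have := ler_wpM2l (ltW c_gt0) kq; lra.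
Qed.

(** The excess of [h] travels back along a path from [i] to [h], one edge per
    window.  The number [n] of windows may be any large number, since a vertex
    also keeps half of its own excess in a window; this allows one [n] for all
    vertices at once. *)
Lemma super_path i h : connect e i h -> exists n0, forall n, (n0 <= n)%N ->
  exists2 D, 0 < D & forall k B, (K <= k)%N -> (forall l, B <= y k l) ->
    y k h - B <= D * (y (iter n (fun k => k + k %/ q)%N k) i - B).
Proof.
have lo n k B : (K <= k)%N -> (forall l, B <= y k l) ->
    (K <= iter n (fun k => k + k %/ q)%N k)%N /\
    forall l, B <= y (iter n (fun k => k + k %/ q)%N k) l.
  move=> Kk HB; elim: n => //= n [K1 H1]; split; last exact: super_bound.
  exact: leq_trans K1 (leq_addr _ _).
case/connectP => s; elim: s i => /= [i _ ->|j s IH i /andP[eij /IH{}IH] /IH].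
  exists 0%N => n _; exists (2 ^+ n) => [|k B Kk HB]; first exact: exprn_gt0.
  elim: n => [|n IH]; first by rewrite expr0 mul1r.
  have [K1 H1] := lo n k B Kk HB.
  apply: le_trans IH _; rewrite /= exprS -mulrA mulrCA ler_wpM2l ?exprn_ge0//.
  by have := super_hold i K1 H1 (leqnn _); lra.
case=> n0 {}IH; exists n0.+1 => -[//|n] nn; have [D D0 HD] := IH n nn.
have c16 : 0 < c / (16 * q%:R) by rewrite divr_gt0// mulr_gt0// ltr0n.
exists (D / (c / (16 * q%:R))) => [|k B Kk HB]; first exact: divr_gt0.
apply: le_trans (HD _ _ Kk HB) _; rewrite -mulrA.
apply: ler_wpM2l; [exact: ltW|rewrite [leRHS]mulrC].
have [K1 H1] := lo n k B Kk HB.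
by rewrite ler_pdivlMr// [leLHS]mulrC; exact: super_gain.
Qed.

(** With [mn] the minimum of [y], the excess [y k h - mn k] is bounded by a multiple
    of the increase of [mn] over finitely many windows, which tends to 0 because
    [mn] is monotone and bounded. *)
Lemma super_cvg h U : (forall i, connect e i h) ->
  (forall k i, (K <= k)%N -> y k i <= U) ->
  exists l : R, exists mn : nat -> R, [/\ forall k i, mn k <= y k i,
    mn k @[k --> \oo] --> l & y k h @[k --> \oo] --> l].
Proof.
move=> hh yU.
pose mn k := \big[Order.min/y k h]_i y k i.
have mnle k i : mn k <= y k i by exact: bigmin_le.
have mnge k B : (forall i, B <= y k i) -> B <= mn k.
  by move=> HB; apply/bigmin_geP; split.
have mn_nd : nondecreasing_seq (fun k => mn (k + K)%N).
  apply/nondecreasing_seqP => k; apply: mnge => i.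
  rewrite addSn -addn1; apply: super_bound => //; exact: leq_addl.
have mn_ub : has_ubound (range (fun k => mn (k + K)%N)).
  exists U => _ [k _ <-]; apply: le_trans (mnle _ h) _.
  by apply: yU; exact: leq_addl.
have mncv := nondecreasing_is_cvgn mn_nd mn_ub.
set l := limn (fun k => mn (k + K)%N) in mncv.
have {}mncv : mn k @[k --> \oo] --> l by rewrite -(cvg_shiftn K).
exists l, mn; split => //.
have [n Hn] : exists n, forall i, exists2 D, 0 < D & forall k B, (K <= k)%N ->
    (forall l, B <= y k l) ->
    y k h - B <= D * (y (iter n (fun k => k + k %/ q)%N k) i - B).
  have /choice[f Hf] := fun i => super_path (hh i).
  exists (\max_i f i)%N => i; apply: Hf; exact: leq_bigmax.
have /choice[D HD] : forall i, exists D, 0 < D /\ forall k B, (K <= k)%N ->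
    (forall l, B <= y k l) ->
    y k h - B <= D * (y (iter n (fun k => k + k %/ q)%N k) i - B).
  by move=> i; have [D D0 HD] := Hn i; exists D.
pose phi := iter n (fun k => k + k %/ q)%N.
have phi_ge k : (k <= phi k)%N.
  rewrite /phi; move: {Hn HD phi} n => n; elim: n => //= n IH.
  exact: leq_trans IH (leq_addr _ _).
have phicv : mn (phi k) @[k --> \oo] --> l.
  apply: (cvg_comp phi mn _ mncv) => A [k _ Ak]; exists k => // j /= kj.
  by apply: Ak => /=; exact: leq_trans kj (phi_ge j).
have up : mn k + (\sum_i D i) * (mn (phi k) - mn k) @[k --> \oo] --> l.
  have lE : l = l + (\sum_i D i) * (l - l) by rewrite subrr mulr0 addr0.
  rewrite [X in _ --> X]lE.
  by apply: cvgD => //; apply: cvgM; [exact: cvg_cst|apply: cvgB].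
apply: squeeze_cvgr mncv up.
near=> k; rewrite mnle/= -lerBlDl.
have Kk : (K <= k)%N by near: k; exact: nbhs_infty_ge.
have [i Hi] : exists i, mn (phi k) = y (phi k) i.
  rewrite /mn; elim/big_ind : _ => [|a b [i ->] [j ->]|i _].
  - by exists h.
  - by rewrite minEle; case: ifP => _; eexists.
  - by exists i.
have [D0 /(_ k (mn k) Kk (mnle k))] := HD i.
move=> H; apply: le_trans H _; rewrite Hi ler_wpM2r//.
  rewrite subr_ge0 -Hi; apply: mnge => j.
  by rewrite -(subnKC (phi_ge k)); exact: super_bound.
rewrite (bigD1 i)//= lerDl sumr_ge0// => j _; exact/ltW/(HD j).1.
Unshelve. all: by end_near.
Qed.
End superharmonic.
End consensus.

Lemma cvg_div_nat (R : realType) (x : R) : x / k%:R @[k --> \oo] --> 0.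
Proof.
rewrite -[X in _ --> X](mulr0 x); apply: cvgM; first exact: cvg_cst.
by rewrite -(@cvg_shiftS R (fun k => k%:R^-1 : R)); exact: cvg_harmonic.
Qed.

(** The errors [E / k ^ 2] are dominated by the decrements of [2 E / k], so that both
    [z k i - 2 E / k] and [- z k i - 2 E / k] dominate their averages.  The minima of
    these two families enclose all the [z k i], and both have the limit of
    [z k h]. *)
Lemma consensus_cvg (R : realType) (N : nat) (e : rel 'I_N)
    (w : nat -> 'I_N -> 'I_N -> R) (z : nat -> 'I_N -> R) (C c E U : R)
    (K : nat) (h : 'I_N) :
  0 <= C -> 0 < c -> (0 < K)%N -> 0 <= E ->
  (forall k i j, (K <= k)%N -> 0 <= w k i j) ->
  (forall k i, (K <= k)%N -> \sum_j w k i j <= C / k%:R) ->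
  (forall k i j, (K <= k)%N -> e i j -> c / k%:R <= w k i j) ->
  (forall k i, (K <= k)%N ->
     `|z k.+1 i - z k i - \sum_j w k i j * (z k j - z k i)| <= E / k%:R ^+ 2) ->
  (forall k i, `|z k i| <= U) -> (forall i, connect e i h) ->
  exists l : R, forall i, z k i @[k --> \oo] --> l.
Proof.
move=> C0 c0 K0 E0 w0 wC wc zE zU eh.
(* Windows of length [k / q] with [q >= 2 C] keep the total weight below 1/2. *)
pose q := (Num.bound (2 * C)).+1.
have qC : 2 * C <= q%:R.
  by apply/ltW/(lt_le_trans (archi_boundP _)); rewrite ?mulr_ge0// ler_nat.
pose K' := maxn K q.
have KK' k : (K' <= k)%N -> (K <= k)%N by apply: leq_trans; exact: leq_maxl.
have w0' k i j (Kk : (K' <= k)%N) := w0 k i j (KK' k Kk).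
have wC' k i (Kk : (K' <= k)%N) := wC k i (KK' k Kk).
have wc' k i j (Kk : (K' <= k)%N) := wc k i j (KK' k Kk).
have tail k : (K' <= k)%N -> E / k%:R ^+ 2 <= 2 * E / k%:R - 2 * E / k.+1%:R.
  move=> Kk; have k0 : (0 < k)%N := leq_trans K0 (KK' _ Kk).
  have kR : 1 <= k%:R :> R by rewrite ler1n.
  have -> : 2 * E / k%:R - 2 * E / k.+1%:R = E * (2 / (k%:R * k.+1%:R)).
    by rewrite -[k.+1%:R]natr1; field; rewrite !lt0r_neq0// ?ltr0n// natr1 ltr0n.
  apply: ler_wpM2l => //; rewrite ler_pdivlMr ?mulr_gt0 ?ltr0n// mulrC.
  rewrite ler_pdivrMr ?exprn_gt0 ?ltr0n// -[k.+1%:R]natr1; nra.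
have super (s : R) : `|s| = 1 -> forall k i, (K' <= k)%N ->
    (s * z k i - 2 * E / k%:R) + \sum_j w k i j *
      ((s * z k j - 2 * E / k%:R) - (s * z k i - 2 * E / k%:R))
    <= s * z k.+1 i - 2 * E / k.+1%:R.
  move=> s1 k i Kk; have zEk := zE k i (KK' _ Kk); have tk := tail k Kk.
  have -> : \sum_j w k i j * (s * z k j - 2 * E / k%:R - (s * z k i - 2 * E / k%:R))
      = s * \sum_j w k i j * (z k j - z k i).
    by rewrite mulr_sumr; apply: eq_bigr => j _; ring.
  set S := \sum_j _ in zEk *.
  have : `|s * (z k.+1 i - z k i - S)| <= E / k%:R ^+ 2 by rewrite normrM s1 mul1r.
  rewrite ler_norml => /andP[H _]; clearbody S.
  by move: H tk; move: (E / _) (2 * E / k%:R) (2 * E / k.+1%:R) => a b c'; lra.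
have ub (s : R) : `|s| = 1 -> forall k i, (K' <= k)%N ->
    s * z k i - 2 * E / k%:R <= U.
  move=> s1 k i Kk; rewrite lerBlDr; apply: le_trans (ler_norm _) _.
  rewrite normrM s1 mul1r; apply: le_trans (zU k i) _.
  by rewrite lerDl divr_ge0// mulr_ge0.
have main (s : R) (s1 : `|s| = 1) := super_cvg w0' wC' wc' c0 (super s s1)
  (ltn0Sn _) C0 qC (leq_maxr _ _) eh (ub s s1).
have [l1 [m1 [m1z m1l z1l]]] := main 1 (normr1 _).
have [l2 [m2 [m2z m2l z2l]]] := main (-1) (normrN1 _).
have c1 := cvg_div_nat (2 * E).
have zh1 : z k h @[k --> \oo] --> l1.
  rewrite -[l1]addr0 (_ : (fun k => z k h) =
    (fun k => (1 * z k h - 2 * E / k%:R) + 2 * E / k%:R)); first exact: cvgD.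
  by apply/funext => k; rewrite subrK mul1r.
have zh2 : z k h @[k --> \oo] --> - l2.
  rewrite -[l2]addr0 (_ : (fun k => z k h) =
    (fun k => - ((- 1 * z k h - 2 * E / k%:R) + 2 * E / k%:R))).
    by apply: cvgN; exact: cvgD.
  by apply/funext => k; rewrite subrK mulN1r opprK.
have l12 : l1 = - l2 by exact: cvg_unique zh1 zh2.
exists l1 => i.
have m2l' : - m2 k @[k --> \oo] --> l1 by rewrite l12; exact: cvgN.
apply: squeeze_cvgr (m1l) (m2l'); near=> k.
have r0 : 0 <= 2 * E / k%:R by rewrite divr_ge0// mulr_ge0.
have := m1z k i; have := m2z k i; rewrite mul1r mulN1r => a b.
apply/andP; split; lra.
Unshelve. all: by end_near.
Qed.

(** * Passing from single steps to blocks of time *)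

Lemma sum_inv_sqr_le (R : realType) n :
  \sum_(k < n) (k.+1%:R ^+ 2)^-1 <= 2 :> R.
Proof.
case: n => [|n]; first by rewrite big_ord0.
suff : \sum_(k < n.+1) (k.+1%:R ^+ 2)^-1 <= 2 - n.+1%:R^-1 :> R.
  by move=> /le_trans; apply; rewrite gerBl invr_ge0.
elim: n => [|n IH]; first by rewrite big_ord1 expr1n invr1; lra.
rewrite big_ord_recr/=; apply: le_trans (lerD IH (lexx _)) _.
have x1 : 1 <= n.+1%:R :> R by rewrite ler1n.
rewrite -[n.+2%:R]natr1; move: x1; move: (n.+1%:R : R) => x x1.
have : x^-1 - (x + 1)^-1 - ((x + 1) ^+ 2)^-1 = (x * (x + 1) ^+ 2)^-1.
  by field; apply/andP; split; rewrite lt0r_neq0//; lra.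
have : 0 <= (x * (x + 1) ^+ 2)^-1 by rewrite invr_ge0 mulr_ge0 ?sqr_ge0//; lra.
lra.
Qed.

Lemma block_le (R : realType) k : (0 < k)%N ->
  (k.+1 ^ 5 - k ^ 5)%:R <= 31 * k%:R ^+ 4 :> R.
Proof.
move=> k0; rewrite natrB ?leq_exp2r// !natrX -natr1.
have : 1 <= k%:R :> R by rewrite ler1n.
move: (k%:R : R) => x x1.
have x2 : 1 <= x ^+ 2 by rewrite exprn_ege1.
have x3 : 1 <= x ^+ 3 by rewrite exprn_ege1.
have x4 : x ^+ 4 = x * x ^+ 3 by ring.
have x4' : x ^+ 4 = x ^+ 2 * x ^+ 2 by ring.
have x5 : x ^+ 3 = x * x ^+ 2 by ring.
have a3 : x ^+ 3 <= x ^+ 4 by rewrite x4 ler_peMl//; lra.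
have a2 : x ^+ 2 <= x ^+ 4 by rewrite x4' ler_peMl//; lra.
have a1 : x <= x ^+ 4 by rewrite x4 ler_peMr//; lra.
have -> : (x + 1) ^+ 5 - x ^+ 5
  = 5 * x ^+ 4 + 10 * x ^+ 3 + 10 * x ^+ 2 + 5 * x + 1 by ring.
lra.
Qed.

Lemma block_ge (R : realType) k : k%:R ^+ 4 <= (k.+1 ^ 5 - k ^ 5)%:R :> R.
Proof.
rewrite natrB ?leq_exp2r// !natrX -natr1.
have : 0 <= k%:R :> R by [].
move: (k%:R : R) => x x1.
have -> : (x + 1) ^+ 5 - x ^+ 5
  = 5 * x ^+ 4 + 10 * x ^+ 3 + 10 * x ^+ 2 + 5 * x + 1 by ring.
have := exprn_ge0 4 x1; have := exprn_ge0 3 x1; have := exprn_ge0 2 x1; lra.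
Qed.

Lemma telescope_norm_le (R : realType) (z : nat -> R) (dl : R) a b : (a <= b)%N ->
  (forall s, (a <= s < b)%N -> `|z s.+1 - z s| <= dl) ->
  `|z b - z a| <= (b - a)%:R * dl.
Proof.
move=> ab H; rewrite -telescope_sumr//; apply: le_trans (ler_norm_sum _ _ _) _.
have -> : (b - a)%:R * dl = \sum_(a <= s < b) dl.
  by rewrite mulr_natl big_const_nat iter_addr_0.
rewrite big_nat_cond [leRHS]big_nat_cond; apply: ler_sum => s; rewrite andbT.
exact: H.
Qed.

(** In block form the increments of [z i] are averaged with the values of [z] at
    the start of the block.  The three error terms are the local errors [rho], the
    accumulated noise [eps], and the cost of freezing [z] in the averages. *)
Lemma block_average (R : realType) (N : nat) (z : nat -> 'I_N -> R)
    (w : nat -> 'I_N -> R) (g : nat -> R) (i : 'I_N) a b (rho dl lam eps : R) :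
  (a <= b)%N -> 0 <= dl ->
  (forall s, (a <= s < b)%N ->
    `|z s.+1 i - z s i - g s - \sum_j w s j * (z s j - z s i)| <= rho) ->
  (forall s j, (a <= s < b)%N -> `|z s.+1 j - z s j| <= dl) ->
  (forall s j, (a <= s < b)%N -> 0 <= w s j) ->
  (forall s, (a <= s < b)%N -> \sum_j w s j <= lam) ->
  `|\sum_(a <= s < b) g s| <= eps ->
  `|z b i - z a i - \sum_j (\sum_(a <= s < b) w s j) * (z a j - z a i)|
  <= (b - a)%:R * rho + eps + (b - a)%:R * (lam * (2 * ((b - a)%:R * dl))).
Proof.
move=> ab dl0 zr zd w0 wl ge.
have -> : z b i - z a i - \sum_j (\sum_(a <= s < b) w s j) * (z a j - z a i) =
  \sum_(a <= s < b) (z s.+1 i - z s i - g s - \sum_j w s j * (z s j - z s i))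
  + \sum_(a <= s < b) g s
  + \sum_(a <= s < b) \sum_j w s j * ((z s j - z s i) - (z a j - z a i)).
  rewrite -(telescope_sumr (fun s => z s i))// -!big_split/=.
  have -> : \sum_j (\sum_(a <= s < b) w s j) * (z a j - z a i)
    = \sum_(a <= s < b) \sum_j w s j * (z a j - z a i).
    by rewrite exchange_big/=; apply: eq_bigr => j _; rewrite mulr_suml.
  rewrite -sumrB; apply: eq_bigr => s _.
  have -> : \sum_j w s j * ((z s j - z s i) - (z a j - z a i))
    = \sum_j w s j * (z s j - z s i) - \sum_j w s j * (z a j - z a i).
    by rewrite -sumrB; apply: eq_bigr => j _; ring.
  by ring.
have cst (c : R) : (b - a)%:R * c = \sum_(a <= s < b) c.
  by rewrite mulr_natl big_const_nat iter_addr_0.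
apply: le_trans (ler_normD _ _) _; apply: lerD.
  apply: le_trans (ler_normD _ _) _; apply: lerD => //.
  apply: le_trans (ler_norm_sum _ _ _) _; rewrite cst big_nat_cond [leRHS]big_nat_cond.
  by apply: ler_sum => s; rewrite andbT; exact: zr.
apply: le_trans (ler_norm_sum _ _ _) _; rewrite [leRHS]cst.
rewrite big_nat_cond [leRHS]big_nat_cond; apply: ler_sum => s; rewrite andbT => sab.
apply: le_trans (ler_norm_sum _ _ _) _.
apply: (@le_trans _ _ (\sum_j w s j * (2 * ((b - a)%:R * dl)))); last first.
  rewrite -mulr_suml; apply: ler_wpM2r; last exact: wl.
  by rewrite !mulr_ge0.
apply: ler_sum => j _; rewrite normrM ger0_norm ?w0//.
apply: ler_wpM2l; first exact: w0.
have mv l : `|z s l - z a l| <= (b - a)%:R * dl.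
  case/andP: sab => as' sb.
  apply: (@le_trans _ _ ((s - a)%:R * dl)).
    apply: (telescope_norm_le (z := z^~ l)) => // r /andP[ar rs]; apply: zd.
    by rewrite ar (ltn_trans rs).
  by apply: ler_wpM2r => //; rewrite ler_nat; apply/leq_sub2r/ltnW.
have -> : z s j - z s i - (z a j - z a i) = (z s j - z a j) - (z s i - z a i) by ring.
by apply: le_trans (ler_normB _ _) _; have := mv j; have := mv i; lra.
Qed.

Lemma exists_block K t : (K ^ 5 <= t)%N ->
  exists2 k, (K <= k)%N & (k ^ 5 <= t < k.+1 ^ 5)%N.
Proof.
elim: t => [|t IH].
  by rewrite leqn0 expn_eq0 andbT => /eqP ->; exists 0%N.
rewrite leq_eqVlt => /predU1P[<-|]; first by exists K => //; rewrite leqnn/= ltn_exp2r.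
rewrite ltnS => /IH[k Kk /andP[kt tk]].
move: tk; rewrite leq_eqVlt => /predU1P[->|tk].
  by exists k.+1; [exact: leqW|rewrite leqnn/= ltn_exp2r].
by exists k => //; rewrite tk (leq_trans kt).
Qed.

Lemma pos_lower_bound (R : realType) (I : finType) (Q : pred I) (f : I -> R) :
  (forall i, Q i -> 0 < f i) -> exists2 c, 0 < c & forall i, Q i -> c <= f i.
Proof.
move=> f0; exists (\big[Order.min/1]_(i | Q i) f i).
  exact: lt_bigmin.
by move=> i Qi; exact: bigmin_le_cond.
Qed.

(** * Histories made of finitely many choices per step *)

Local Notation upd := eqtype.dfwith.

(** [F] is measurable with respect to the first [t] choices. *)
Definition adapted (S : nat -> finType) (V : Type) (t : nat)
    (F : (forall s, S s) -> V) :=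
  forall h h' : forall s, S s, (forall s, (s < t)%N -> h s = h' s) -> F h = F h'.

Section finite_process.
Variables (R : realType) (S : nat -> finType).
Local Notation hist := (forall t, S t).
Variable kern : forall t, hist -> S t -> R.

(** When [F] depends on the choices up to time [t] only, this is its conditional
    expectation given those before [t]. *)
Definition mean_step t (F : hist -> R) (h : hist) : R :=
  \sum_(a : S t) kern h a * F (upd h a).

(** The conditional expectation given the choices before [t], when the choices at
    times [t], ..., [t + n - 1] are drawn one after the other. *)
Fixpoint mean_from n t (F : hist -> R) (h : hist) : R :=
  if n is n'.+1 then mean_step t (mean_from n' t.+1 F) h else F h.

Lemma adapted_upd V t (F : hist -> V) (h : hist) (a : S t) :
  adapted t F -> F (upd h a) = F h.
Proof.
move=> aF; apply: aF => s st; rewrite dfwith_out//.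
by rewrite gt_eqF//; exact: st.
Qed.

Lemma mean_from_recr n t F h :
  mean_from n.+1 t F h = mean_from n t (mean_step (t + n) F) h.
Proof.
elim: n t h => [|n IH] t h; first by rewrite addn0.
by rewrite /=; apply: eq_bigr => a _; rewrite -addSnnS -IH.
Qed.

Hypothesis kern_ge0 : forall t (h : hist) (a : S t), 0 <= kern h a.
Hypothesis kern_sum1 : forall t (h : hist), \sum_(a : S t) kern h a = 1.

Lemma le_mean_step t (F G : hist -> R) h : (forall h, F h <= G h) ->
  mean_step t F h <= mean_step t G h.
Proof. by move=> FG; apply: ler_sum => a _; apply: ler_wpM2l. Qed.

Lemma le_mean_from n t (F G : hist -> R) h : (forall h, F h <= G h) ->
  mean_from n t F h <= mean_from n t G h.
Proof. by move=> FG; elim: n t h => //= n IH t h; apply: le_mean_step => h'. Qed.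

Lemma mean_from_addr n t (F : hist -> R) b h :
  mean_from n t (fun h => F h + b) h = mean_from n t F h + b.
Proof.
elim: n t h => //= n IH t h; rewrite /mean_step; under eq_bigr do rewrite IH mulrDr.
by rewrite big_split/= -mulr_suml kern_sum1 mul1r.
Qed.

Lemma mean_fromZ n t (F : hist -> R) b h :
  mean_from n t (fun h => b * F h) h = b * mean_from n t F h.
Proof.
elim: n t h => //= n IH t h; rewrite /mean_step mulr_sumr.
by apply: eq_bigr => a _; rewrite IH mulrCA.
Qed.

Section second_moment.
Variables (xi : nat -> hist -> R) (v : nat -> R).
Hypothesis xi_adapted : forall s, adapted s.+1 (xi s).
Hypothesis xi_center : forall s h, mean_step s (xi s) h = 0.
Hypothesis xi_le : forall s h, `|xi s h| ^+ 2 <= v s.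

Lemma adapted_sum a b : adapted b (fun h => \sum_(a <= s < b) xi s h).
Proof.
move=> h h' hh'; apply: eq_big_nat => s /andP[_ sb]; apply: xi_adapted => r rs.
by apply: hh'; exact: leq_trans rs sb.
Qed.

(** Peeling off the last choice, the cross term vanishes because the earlier
    increments are fixed and the last one is centred. *)
Lemma second_moment_le a b h : (a <= b)%N ->
  mean_from b 0 (fun h => (\sum_(a <= s < b) xi s h) ^+ 2) h <= \sum_(a <= s < b) v s.
Proof.
move=> /subnKC <-; elim: (b - a)%N => {b} [|n IH].
  rewrite addn0 [leRHS]big_geq// [X in mean_from _ _ X](_ : _ = fun=> 0 * 0).
    by rewrite mean_fromZ mul0r.
  by apply/funext => h'; rewrite big_geq// expr0n/= mulr0.
rewrite addnS mean_from_recr add0n; set b := (a + n)%N in IH *.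
have ab : (a <= b)%N by exact: leq_addr.
rewrite [leRHS]big_nat_recr//=.
apply: le_trans (lerD IH (lexx (v b))); rewrite -mean_from_addr.
apply: le_mean_from => h'.
rewrite /mean_step; set s0 := \sum_(a <= s < b) xi s h'.
have E (c : S b) : (\sum_(a <= s < b.+1) xi s (upd h' c)) ^+ 2 =
    s0 ^+ 2 + 2 * s0 * xi b (upd h' c) + (xi b (upd h' c)) ^+ 2.
  rewrite big_nat_recr//= (@adapted_upd _ _ _ h' c (@adapted_sum a b)) -/s0; ring.
under eq_bigr do rewrite E !mulrDr.
rewrite !big_split/= -mulr_suml kern_sum1 mul1r.
have -> : \sum_(i : S b) kern h' i * (2 * s0 * xi b (upd h' i)) = 0.
  under eq_bigr do rewrite mulrCA.
  by rewrite -mulr_sumr -[X in _ * X]/(mean_step b (xi b) h') xi_center mulr0.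
rewrite addr0 lerD2l -[leRHS]mul1r -(kern_sum1 b h') mulr_suml.
apply: ler_sum => c _; apply: ler_wpM2l => //.
by rewrite -[_ ^+ 2]ger0_norm ?sqr_ge0// normrX.
Qed.
End second_moment.

Section law.
Context d (T : measurableType d) (P : probability T R) (X : forall t, T -> S t).
Hypothesis X_measurable : forall t (a : S t), measurable [set x | X t x = a].

Definition same_past (h : hist) t : set T :=
  [set x | forall s, (s < t)%N -> X s x = h s].

Hypothesis X_law : forall (h : hist) t (a : S t),
  P (same_past h t `&` [set x | X t x = a]) = (P (same_past h t) * (kern h a)%:E)%E.

(** Induction on [t]: split according to the value of the last choice, which takes
    finitely many values. *)
Lemma measurable_adapted t (B : hist -> Prop) : adapted t B ->
  measurable [set x | B (fun s => X s x)].
Proof.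
elim: t B => [|t IH] B aB.
  have [b|nb] := pselect (exists h, B h).
    rewrite (_ : [set x | _] = setT)//; apply/seteqP; split => // x _ /=.
    by have [h Bh] := b; rewrite (aB _ h).
  rewrite (_ : [set x | _] = set0)//; apply/seteqP; split => // x /= Bx.
  by apply: nb; eexists; exact: Bx.
rewrite (_ : [set x | _] = \bigcup_(a in [set: S t])
    ([set x | X t x = a] `&` [set x | B (upd (fun s => X s x) a)])).
  apply: fin_bigcup_measurable => [|a _]; first exact: finite_finset.
  apply: measurableI => //.
  apply: (IH (fun h => B (upd h a))) => h h' hh'; apply: aB => s st.
  case: (eqVneq t s) => [<-|ts]; first by rewrite !dfwith_in.
  rewrite !dfwith_out//; apply: hh'.
  by move: st; rewrite ltnS leq_eqVlt eq_sym (negPf ts).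
apply/seteqP; split => x /=.
  move=> Bx; exists (X t x) => //; split => //=.
  rewrite -(_ : (fun s => X s x) = upd (fun s => X s x) (X t x))//.
  by apply: functional_extensionality_dep => s; case: eqtype.dfwithP.
move=> [a _ [/= Xa]]; rewrite -Xa.
rewrite -(_ : (fun s => X s x) = upd (fun s => X s x) (X t x))//.
by apply: functional_extensionality_dep => s; case: eqtype.dfwithP.
Qed.

Lemma measurable_same_past h t : measurable (same_past h t).
Proof.
apply: (@measurable_adapted t (fun h' => forall s, (s < t)%N -> h' s = h s)).
move=> h1 h2 h12; apply/propext; split => H s st; first by rewrite -h12// H.
by rewrite h12// H.
Qed.

Lemma same_past_upd h t a :
  same_past (upd h a) t.+1 = same_past h t `&` [set x | X t x = a].
Proof.
apply/seteqP; split => x /=.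
  move=> H; split; last by rewrite H// dfwith_in.
  move=> s st; rewrite H; last exact: ltnW.
  by rewrite dfwith_out// gt_eqF//; exact: st.
move=> [H Xa] s; case: (eqVneq t s) => [<-|ts] st; first by rewrite dfwith_in.
by rewrite dfwith_out// H//; move: st; rewrite ltnS leq_eqVlt eq_sym (negPf ts).
Qed.

(** The bridge between finite sums and the probability [P].  Induction on the number
    of free choices: at the end the event is decided by the past, and each further
    choice splits the past into finitely many disjoint cases. *)
Lemma same_past_mean n j (B : hist -> Prop) h : adapted (j + n) B ->
  P (same_past h j `&` [set x | B (fun s => X s x)])
  = (P (same_past h j) * (mean_from n j (fun h => (`[< B h >])%:R) h)%:E)%E.
Proof.
elim: n j h => [|n IH] j h aB /=.
  rewrite addn0 in aB; case: asboolP => Bh.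
    rewrite mule1; congr (P _); apply/seteqP; split => x /=; first by case.
    by move=> H; split => //; rewrite (aB _ h).
  rewrite mule0 (_ : _ `&` _ = set0) ?measure0//; apply/seteqP; split => // x /= [H].
  by rewrite (aB _ h).
have mB := measurable_adapted aB.
rewrite (_ : _ `&` _ = \bigcup_(a in [set: S j])
    (same_past (upd h a) j.+1 `&` [set x | B (fun s => X s x)])); last first.
  apply/seteqP; split => x /=.
    by move=> [H Bx]; exists (X j x) => //; rewrite same_past_upd.
  by move=> [a _ /=]; rewrite same_past_upd => -[[? _] ?].
rewrite measure_fin_bigcup//.
- rewrite (_ : [set: S j] = [set` index_enum (S j)]); last first.
    by apply/seteqP; split => a //= _; rewrite mem_index_enum.
  rewrite -fsbig_seq ?index_enum_uniq// /mean_step -sumEFin ge0_sume_distrr; last first.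
    move=> a _; rewrite lee_fin mulr_ge0//.
    rewrite -(mul0r (mean_from n j.+1 (fun=> 0) (upd h a))) -mean_fromZ.
    by apply: le_mean_from => h'; rewrite mul0r.
  apply: eq_bigr => a _; have := IH j.+1 (upd h a); rewrite addSnnS => /(_ aB) E.
  by rewrite [LHS]E same_past_upd X_law EFinM muleA.
- exact: finite_finset.
- move=> a b _ _ [x [[+ _] [+ _]]]; rewrite !same_past_upd => -[_ /= <-] [_ /= <-]//.
- move=> a _; apply: measurableI => //; exact: measurable_same_past.
Qed.

(** The event is decided by the first [b] choices, so its probability is a finite
    mean, which Markov's inequality bounds by the second moment. *)
Lemma martingale_chebyshev (xi : nat -> hist -> R) (v : nat -> R) a b (eps : R)
    (h0 : hist) :
  (forall s, adapted s.+1 (xi s)) ->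
  (forall s h, mean_step s (xi s) h = 0) ->
  (forall s h, `|xi s h| ^+ 2 <= v s) -> (a <= b)%N -> 0 < eps ->
  (P [set x | (eps < `|\sum_(a <= s < b) xi s (fun s => X s x)|)%R]
    <= ((\sum_(a <= s < b) v s) / eps ^+ 2)%R%:E)%E.
Proof.
move=> xa xc xv ab e0.
pose B (h : hist) : Prop := eps < `|\sum_(a <= s < b) xi s h|.
have aB : adapted b B by move=> h h' hh'; rewrite /B (@adapted_sum _ xa a b h h' hh').
have := @same_past_mean b 0 B h0 aB.
rewrite (_ : same_past _ _ = setT); last by apply/seteqP; split.
rewrite setTI probability_setT mul1e => ->; rewrite lee_fin.
rewrite ler_pdivlMr ?exprn_gt0// mulrC -mean_fromZ.
apply: le_trans (second_moment_le xa xc xv h0 ab); apply: le_mean_from => h.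
case: asboolP => Bh; last by rewrite mulr0 sqr_ge0.
rewrite mulr1 -[leRHS]ger0_norm ?sqr_ge0// normrX.
by apply: lerXn2r; rewrite ?nnegrE ?(ltW e0)//; exact: ltW Bh.
Qed.
End law.
End finite_process.

(** * Independent choices of the neighbours *)

Section tuple_sums.
Variables (R : comRingType) (I : finType) (m : nat).

Lemma sum_tuple_prod (F : 'I_m -> I -> R) :
  \sum_(w : m.-tuple I) \prod_(j < m) F j (tnth w j) = \prod_(j < m) \sum_v F j v.
Proof.
rewrite bigA_distr_bigA/=.
rewrite (reindex (fun f : {ffun 'I_m -> I} => [tuple f j | j < m]))/=; last first.
  exists (fun w : m.-tuple I => [ffun j => tnth w j]) => x _.
    by apply/ffunP => j; rewrite ffunE tnth_mktuple.
  by apply: eq_from_tnth => j; rewrite tnth_mktuple ffunE.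
by apply: eq_bigr => f _; apply: eq_bigr => j _; rewrite tnth_mktuple.
Qed.

Lemma sum_tuple_mean (q f : I -> R) : \sum_v q v = 1 ->
  \sum_(w : m.-tuple I) (\prod_(j < m) q (tnth w j)) * (\sum_(u <- w) f u)
  = m%:R * \sum_v q v * f v.
Proof.
move=> q1; under eq_bigr do rewrite big_tuple mulr_sumr.
rewrite exchange_big/= -[m in RHS]card_ord -sum1_card natr_sum mulr_suml.
apply: eq_bigr => l _; rewrite mul1r.
rewrite (eq_bigr (fun w : m.-tuple I => \prod_(j < m)
    (q (tnth w j) * (if j == l then f (tnth w j) else 1)))); last first.
  move=> w _; rewrite big_split/=; congr (_ * _).
  by rewrite -big_mkcond/= big_pred1_eq.
rewrite (sum_tuple_prod (fun j v => q v * (if j == l then f v else 1))).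
rewrite (bigD1 l)//= eqxx [X in _ * X]big1 ?mulr1// => j /negPf ->.
by rewrite -[RHS]q1; apply: eq_bigr => v _; rewrite mulr1.
Qed.
End tuple_sums.

(** * One arrival *)

(** The mean over the colour of a newcomer that has [k] red neighbours among [m];
    [e] tells whether it lies in the community considered, [z] is the red
    proportion there, and [v] is the contribution of the chosen neighbours. *)
Lemma copy_mean (R : fieldType) (k e z v : R) (m : nat) : m%:R != 0 :> R ->
  k / m%:R * ((e * (true%:R - z)) *+ m + v)
  + (1 - k / m%:R) * ((e * (false%:R - z)) *+ m + v)
  = e * (k + (- z) *+ m) + v.
Proof.
move=> m0; rewrite mulr1n mulr0n -[_ *+ m]mulr_natr -[(e * (0 - z)) *+ m]mulr_natr.
by rewrite -[(- z) *+ m]mulr_natr; field.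
Qed.

Section graph.
Variables (R : realType) (N m : nat).
Implicit Types (i j c : 'I_N).

Lemma deg_sum n (g : cgraph N n) (f : 'I_n -> R) :
  \sum_v f v * (deg g v)%:R = \sum_(e <- edges g) (f e.1 + f e.2).
Proof.
rewrite /deg; under eq_bigr do rewrite natr_sum mulr_sumr.
rewrite exchange_big/=; apply: eq_bigr => e _.
under eq_bigr do rewrite natrD mulrDr.
rewrite big_split/=; congr (_ + _).
  rewrite (bigD1 e.1)//= eqxx mulr1 big1 ?addr0// => v /negPf.
  by rewrite eq_sym => ->; rewrite mulr0.
rewrite (bigD1 e.2)//= eqxx mulr1 big1 ?addr0// => v /negPf.
by rewrite eq_sym => ->; rewrite mulr0.
Qed.

Lemma deg_sum_add n (g : cgraph N n) (a : arrival N m n) (f : 'I_n.+1 -> R) :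
  \sum_v f v * (deg (add_vertex g a) v)%:R
  = \sum_v f (lift ord_max v) * (deg g v)%:R
    + \sum_(u <- anbrs a) (f ord_max + f (lift ord_max u)).
Proof. by rewrite !deg_sum/= big_cat/= !big_map. Qed.

Definition comm_deg n (g : cgraph N n) i : R :=
  \sum_v (comm g v == i)%:R * (deg g v)%:R.

Definition red_deg n (g : cgraph N n) i : R :=
  \sum_v ((comm g v == i)%:R * (red g v)%:R) * (deg g v)%:R.

Lemma red_propE n (g : cgraph N n) i : red_prop R g i = red_deg g i / comm_deg g i.
Proof.
rewrite /red_prop /red_deg /comm_deg !natr_sum; congr (_ / _).
  by rewrite big_mkcond; apply: eq_bigr => v _; case: red; case: eqP;
    rewrite ?(mul0r, mulr0, mul1r).
by rewrite big_mkcond; apply: eq_bigr => v _; case: eqP; rewrite ?(mul0r, mul1r).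
Qed.

Lemma comm_deg_add n (g : cgraph N n) (a : arrival N m n) i :
  comm_deg (add_vertex g a) i = comm_deg g i
    + \sum_(u <- anbrs a) ((acomm a == i)%:R + (comm g u == i)%:R).
Proof.
rewrite /comm_deg deg_sum_add/= unlift_none; congr (_ + _).
  by apply: eq_bigr => v _; rewrite liftK.
by apply: eq_bigr => v _; rewrite liftK.
Qed.

Lemma red_deg_add n (g : cgraph N n) (a : arrival N m n) i :
  red_deg (add_vertex g a) i = red_deg g i
    + \sum_(u <- anbrs a) ((acomm a == i)%:R * (ared a)%:R
                           + (comm g u == i)%:R * (red g u)%:R).
Proof.
rewrite /red_deg deg_sum_add/= unlift_none; congr (_ + _).
  by apply: eq_bigr => v _; rewrite liftK.
by apply: eq_bigr => v _; rewrite liftK.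
Qed.

Lemma comm_deg_ge0 n (g : cgraph N n) i : 0 <= comm_deg g i.
Proof. by apply: sumr_ge0 => v _; rewrite mulr_ge0. Qed.

Lemma red_deg_ge0 n (g : cgraph N n) i : 0 <= red_deg g i.
Proof. by apply: sumr_ge0 => v _; rewrite !mulr_ge0. Qed.

Lemma red_deg_le n (g : cgraph N n) i : red_deg g i <= comm_deg g i.
Proof.
by apply: ler_sum => v _; apply: ler_wpM2r => //; case: red; rewrite ?mulr1 ?mulr0.
Qed.

Lemma comm_deg_le_edges n (g : cgraph N n) i : comm_deg g i <= 2 * (size (edges g))%:R.
Proof.
rewrite /comm_deg deg_sum -sum1_size natr_sum mulr_sumr; apply: ler_sum => e _.
by do 2 case: eqP => _; rewrite ?mulr1 ?addr0 ?add0r ?ler1n//; lra.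
Qed.

Lemma red_prop_itv n (g : cgraph N n) i : 0 <= red_prop R g i <= 1.
Proof.
rewrite red_propE divr_ge0 ?red_deg_ge0 ?comm_deg_ge0//=.
have [->|D0] := eqVneq (comm_deg g i) 0; first by rewrite invr0 mulr0.
by rewrite ler_pdivrMr ?mul1r ?red_deg_le// lt0r D0 comm_deg_ge0.
Qed.

Lemma red_propM n (g : cgraph N n) i : red_prop R g i * comm_deg g i = red_deg g i.
Proof.
rewrite red_propE; have [D0|D0] := eqVneq (comm_deg g i) 0; last by rewrite divfK.
apply/eqP; rewrite D0 mulr0 eq_sym eq_le red_deg_ge0 andbT -[leRHS]D0.
exact: red_deg_le.
Qed.

Section kernel.
Variables (mu : 'I_N -> R) (A : 'M[R]_N) (p : nat -> R).
Hypothesis m_gt0 : (0 < m)%N.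
Hypothesis mu_ge0 : forall i, 0 <= mu i.
Hypothesis mu_sum1 : \sum_i mu i = 1.
Hypothesis A_ge0 : forall x y, 0 <= A x y.
Hypothesis A_col_gt0 : forall y, 0 < \sum_x A x y.
Hypothesis p_01 : forall k, (k <= m)%N -> 0 <= p k <= 1.
Hypothesis p_linear : forall k, (k <= m)%N -> p k = k%:R / m%:R.

Definition arrival_law n (g : cgraph N n) (a : arrival N m n) : R :=
  mu (acomm a) * (\prod_(j < m) attach_prob A g (acomm a) (tnth (anbrs a) j))
  * (if ared a then p (red_count g (anbrs a)) else 1 - p (red_count g (anbrs a))).

Lemma red_count_le n (g : cgraph N n) (w : m.-tuple 'I_n) : (red_count g w <= m)%N.
Proof. by rewrite -[leqRHS](size_tuple w) count_size. Qed.

Lemma attach_sum n (g : cgraph N n) c (f : 'I_n -> R) :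
  \sum_v attach_prob A g c v * f v
  = (\sum_v f v * A (comm g v) c * (deg g v)%:R)
    / \sum_u A (comm g u) c * (deg g u)%:R.
Proof.
by rewrite mulr_suml; apply: eq_bigr => v _; rewrite /attach_prob; ring.
Qed.

Lemma attach_denom n (g : cgraph N n) c :
  \sum_u A (comm g u) c * (deg g u)%:R = \sum_j A j c * comm_deg g j.
Proof.
under [RHS]eq_bigr do rewrite mulr_sumr.
rewrite exchange_big/=; apply: eq_bigr => u _.
rewrite (bigD1 (comm g u))//= eqxx mul1r big1 ?addr0// => j /negPf.
by rewrite eq_sym => ->; rewrite mul0r mulr0.
Qed.

Lemma attach_ge0 n (g : cgraph N n) c v : 0 <= attach_prob A g c v.
Proof.
by rewrite divr_ge0 ?sumr_ge0 ?mulr_ge0// => u _; rewrite mulr_ge0.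
Qed.

Lemma arrival_law_ge0 n (g : cgraph N n) a : 0 <= arrival_law g a.
Proof.
rewrite !mulr_ge0// ?prodr_ge0// => [j _|]; first exact: attach_ge0.
by have /andP[] := p_01 (red_count_le g (anbrs a)); case: ifP => // _; rewrite subr_ge0.
Qed.

Section nondegenerate.
Variables (n : nat) (g : cgraph N n).
Hypothesis comm_deg_gt0 : forall i, 0 < comm_deg g i.

Lemma attach_denom_gt0 c : 0 < \sum_u A (comm g u) c * (deg g u)%:R.
Proof.
rewrite attach_denom lt_neqAle eq_sym sumr_ge0 ?andbT; last first.
  by move=> j _; rewrite mulr_ge0// comm_deg_ge0.
apply/negP => /eqP/psumr_eq0P H.
have := A_col_gt0 c; rewrite big1 ?ltxx// => j _.
have /eqP := H (fun j _ => mulr_ge0 (A_ge0 j c) (comm_deg_ge0 g j)) j isT.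
by rewrite mulf_eq0 [comm_deg _ _ == 0]gt_eqF// orbF => /eqP.
Qed.

Lemma attach_sum1 c : \sum_v attach_prob A g c v = 1.
Proof.
rewrite (eq_bigr (fun v => attach_prob A g c v * 1)); last by move=> v _; rewrite mulr1.
rewrite attach_sum; under eq_bigr do rewrite mul1r.
by rewrite divff// gt_eqF// attach_denom_gt0.
Qed.

Lemma arrival_mean (f : arrival N m n -> R) :
  \sum_a arrival_law g a * f a
  = \sum_c mu c * \sum_(w : m.-tuple 'I_n)
      (\prod_(j < m) attach_prob A g c (tnth w j)) *
      (p (red_count g w) * f (c, w, true) + (1 - p (red_count g w)) * f (c, w, false)).
Proof.
pose F (cw : 'I_N * m.-tuple 'I_n) (b : bool) := arrival_law g (cw, b) * f (cw, b).
transitivity (\sum_cw \sum_b F cw b); first by rewrite pair_bigA; apply: eq_bigr => -[].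
transitivity (\sum_c \sum_(w : m.-tuple 'I_n) \sum_b F (c, w) b).
  by rewrite [RHS]pair_bigA; apply: eq_bigr => -[].
rewrite /F.
apply: eq_bigr => c _; rewrite mulr_sumr; apply: eq_bigr => w _.
by rewrite big_bool /arrival_law /acomm /anbrs /ared/=; ring.
Qed.

Lemma arrival_law_sum1 : \sum_a arrival_law g a = 1.
Proof.
rewrite (eq_bigr (fun a => arrival_law g a * 1)); last by move=> v _; rewrite mulr1.
rewrite arrival_mean -[RHS]mu_sum1; apply: eq_bigr => c _.
rewrite (eq_bigr (fun w : m.-tuple 'I_n => \prod_(j < m) attach_prob A g c (tnth w j))).
  rewrite (sum_tuple_prod (fun=> attach_prob A g c)) big1 ?mulr1// => j _.
  exact: attach_sum1.
by move=> w _; ring.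
Qed.

(** The change of [red_deg g i] in excess of [red_prop R g i] times the change of
    [comm_deg g i]; it is the numerator of the change of [red_prop R g i]. *)
Definition red_gain i (a : arrival N m n) : R :=
  \sum_(u <- anbrs a) ((acomm a == i)%:R * ((ared a)%:R - red_prop R g i)
                       + (comm g u == i)%:R * ((red g u)%:R - red_prop R g i)).

(** The probability that a neighbour chosen by a newcomer of community [i] lies in
    community [j]. *)
Definition attach_comm i j : R := A j i * comm_deg g j / \sum_h A h i * comm_deg g h.

Definition drift i : R :=
  m%:R * mu i * \sum_j attach_comm i j * (red_prop R g j - red_prop R g i).

Lemma attach_red c : \sum_v attach_prob A g c v * (red g v)%:R
  = \sum_j attach_comm c j * red_prop R g j.
Proof.
rewrite attach_sum attach_denom /attach_comm.
transitivity (\sum_j A j c * red_deg g j / \sum_h A h c * comm_deg g h); last first.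
  by apply: eq_bigr => j _; rewrite -red_propM; ring.
rewrite -mulr_suml; congr (_ / _); under [RHS]eq_bigr do rewrite mulr_sumr.
rewrite exchange_big/=; apply: eq_bigr => u _.
rewrite (bigD1 (comm g u))//= eqxx mul1r big1 ?addr0; last first.
  by move=> j /negPf; rewrite eq_sym => ->; rewrite !mul0r mulr0.
by ring.
Qed.

Lemma attach_comm_sum1 c : \sum_j attach_comm c j = 1.
Proof.
rewrite -mulr_suml divff// -attach_denom gt_eqF//; exact: attach_denom_gt0.
Qed.

(** An edge-end landing in community [i] is red with conditional probability equal
    to the red proportion there, so it does not bias that proportion. *)
Lemma attach_own_mean c i : \sum_v attach_prob A g c v *
  ((comm g v == i)%:R * ((red g v)%:R - red_prop R g i)) = 0.
Proof.
rewrite attach_sum.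
have -> : \sum_v (comm g v == i)%:R * ((red g v)%:R - red_prop R g i)
    * A (comm g v) c * (deg g v)%:R
    = A i c * (red_deg g i - red_prop R g i * comm_deg g i).
  rewrite mulrBr /red_deg /comm_deg !mulr_sumr -sumrB; apply: eq_bigr => v _.
  rewrite [X in X * _]mulrAC.
  have -> : (comm g v == i)%:R * A (comm g v) c = (comm g v == i)%:R * A i c.
    by case: eqP => [->|_]; rewrite ?mul0r.
  by ring.
by rewrite red_propM subrr mulr0 mul0r.
Qed.

(** This is where linearity of the type assignment enters: the mean colour of the
    newcomer is the fraction of red among its neighbours, whose mean is a convex
    combination of the red proportions of the communities. *)
Lemma red_gain_mean i : \sum_a arrival_law g a * red_gain i a = drift i.
Proof.
set Z := red_prop R g i.
rewrite arrival_mean.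
have E c (w : m.-tuple 'I_n) :
    p (red_count g w) * red_gain i (c, w, true)
    + (1 - p (red_count g w)) * red_gain i (c, w, false)
    = \sum_(u <- w) ((c == i)%:R * ((red g u)%:R - Z)
                     + (comm g u == i)%:R * ((red g u)%:R - Z)).
  rewrite /red_gain /acomm /anbrs /ared/= -/Z.
  rewrite !big_split/= !big_const_seq !count_predT !iter_addr_0 size_tuple.
  rewrite -mulr_sumr big_split/= big_const_seq count_predT iter_addr_0 size_tuple.
  have -> : \sum_(u <- w) (red g u)%:R = (red_count g w)%:R :> R.
    rewrite /red_count -sum1_count natr_sum [RHS]big_mkcond.
    by apply: eq_bigr => u _; case: red.
  rewrite p_linear ?red_count_le//.
  by rewrite copy_mean ?pnatr_eq0 -?lt0n.
under eq_bigr => c _ do under eq_bigr => w _ do rewrite E.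
under eq_bigr => c _ do rewrite (sum_tuple_mean m _ (attach_sum1 c)).
have M c : \sum_v attach_prob A g c v * ((c == i)%:R * ((red g v)%:R - Z)
      + (comm g v == i)%:R * ((red g v)%:R - Z))
    = (c == i)%:R * \sum_j attach_comm c j * (red_prop R g j - Z).
  under eq_bigr do rewrite mulrDr.
  rewrite big_split/= attach_own_mean addr0.
  under eq_bigr do rewrite mulrCA.
  rewrite -mulr_sumr; congr (_ * _).
  under [LHS]eq_bigr do rewrite mulrBr.
  under [RHS]eq_bigr do rewrite mulrBr.
  rewrite !sumrB.
  have -> : \sum_v attach_prob A g c v * Z = (\sum_v attach_prob A g c v) * Z.
    by rewrite mulr_suml.
  have -> : \sum_j attach_comm c j * Z = (\sum_j attach_comm c j) * Z.
    by rewrite mulr_suml.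
  by rewrite attach_red attach_sum1 attach_comm_sum1.
under eq_bigr do rewrite M.
rewrite (bigD1 i)//= [X in _ + X]big1 ?addr0 => [|c /negPf ci].
  by rewrite eqxx mul1r /drift -/Z; ring.
by rewrite ci mul0r !mulr0.
Qed.

Lemma attach_comm_ge0 i j : 0 <= attach_comm i j.
Proof.
rewrite divr_ge0 ?mulr_ge0 ?comm_deg_ge0// sumr_ge0// => h _.
by rewrite mulr_ge0 ?comm_deg_ge0.
Qed.

Lemma newcomer_comm_mean i : \sum_a arrival_law g a * (acomm a == i)%:R = mu i.
Proof.
rewrite arrival_mean (bigD1 i)//= [X in _ + X]big1 ?addr0 => [|c /negPf ci].
  rewrite (eq_bigr (fun w : m.-tuple 'I_n =>
    \prod_(j < m) attach_prob A g i (tnth w j))).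
    rewrite (sum_tuple_prod (fun=> attach_prob A g i)) big1 ?mulr1// => j _.
    exact: attach_sum1.
  by move=> w _; rewrite /acomm/= eqxx mulr1n; ring.
by rewrite big1 ?mulr0// => w _; rewrite /acomm/= ci mulr0n; ring.
Qed.

Lemma red_diff_le1 i (b : bool) : `|b%:R - red_prop R g i| <= 1.
Proof.
have /andP[z0 z1] := red_prop_itv g i.
by rewrite ler_norml; case: b; rewrite ?mulr1n ?mulr0n; apply/andP; split; lra.
Qed.

Lemma red_gain_le i a : `|red_gain i a| <= 2 * m%:R.
Proof.
apply: le_trans (ler_norm_sum _ _ _) _.
apply: (@le_trans _ _ (\sum_(u <- anbrs a) 2)); last first.
  by rewrite big_const_seq count_predT iter_addr_0 size_tuple mulr_natr.
apply: ler_sum => u _; apply: le_trans (ler_normD _ _) _.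
have b1 (b : bool) : `|b%:R : R| <= 1 by case: b; rewrite ?normr0 ?normr1.
have e1 (b b' : bool) : `|b%:R * (b'%:R - red_prop R g i)| <= 1.
  by rewrite normrM; apply: mulr_ile1 => //; exact: red_diff_le1.
by apply: le_trans (lerD (e1 _ _) (e1 _ _)) _; lra.
Qed.

Lemma drift_le i : `|drift i| <= m%:R.
Proof.
have mu1 : mu i <= 1 by rewrite -mu_sum1 (bigD1 i)//= lerDl sumr_ge0.
rewrite /drift normrM ger0_norm; last by rewrite mulr_ge0.
rewrite -[leRHS]mulr1 -mulrA; apply: ler_wpM2l => //; apply: mulr_ile1 => //.
apply: le_trans (ler_norm_sum _ _ _) _; rewrite -(attach_comm_sum1 i).
apply: ler_sum => j _; rewrite normrM ger0_norm ?attach_comm_ge0//.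
rewrite -[leRHS]mulr1; apply: ler_wpM2l; first exact: attach_comm_ge0.
have /andP[z0 z1] := red_prop_itv g i.
have /andP[y0 y1] := red_prop_itv g j.
by rewrite ler_norml; apply/andP; split; lra.
Qed.

Lemma comm_deg_add_ge i (a : arrival N m n) :
  comm_deg g i + m%:R * (acomm a == i)%:R <= comm_deg (add_vertex g a) i.
Proof.
rewrite comm_deg_add lerD2l big_split/=.
rewrite big_const_seq count_predT iter_addr_0 size_tuple.
by rewrite mulr_natl lerDl sumr_ge0.
Qed.

Lemma comm_deg_add_le i (a : arrival N m n) :
  comm_deg (add_vertex g a) i <= comm_deg g i + 2 * m%:R.
Proof.
rewrite comm_deg_add lerD2l.
apply: (@le_trans _ _ (\sum_(u <- anbrs a) 2)); last first.
  by rewrite big_const_seq count_predT iter_addr_0 size_tuple mulr_natr.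
by apply: ler_sum => u _; do 2 case: eqP => _; rewrite /= ?addr0 ?add0r//; lra.
Qed.

Lemma red_prop_add i (a : arrival N m n) :
  red_prop R (add_vertex g a) i - red_prop R g i
  = red_gain i a / comm_deg (add_vertex g a) i.
Proof.
have D0 : 0 < comm_deg (add_vertex g a) i.
  by apply: lt_le_trans (comm_deg_add_ge i a); rewrite ltr_wpDr// mulr_ge0.
apply/eqP; rewrite -[_ == _](inj_eq (mulIf (lt0r_neq0 D0))) divfK ?lt0r_neq0//.
rewrite mulrBl red_propM red_deg_add comm_deg_add.
rewrite [red_prop R g i * (_ + _)]mulrDr red_propM opprD addrACA subrr add0r.
rewrite mulr_sumr -sumrB; apply/eqP; apply: eq_bigr => u _; ring.
Qed.
End nondegenerate.
End kernel.
End graph.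

(** * Irregular blocks and the block recursion *)

Section process.
Variables (R : realType) (N m n0 : nat).
Variables (mu : 'I_N -> R) (A : 'M[R]_N) (p : nat -> R) (G0 : cgraph N n0).
Hypothesis m_gt0 : (0 < m)%N.
Hypothesis mu_gt0 : forall i, 0 < mu i.
Hypothesis mu_sum1 : \sum_i mu i = 1.
Hypothesis A_ge0 : forall x y, 0 <= A x y.
Hypothesis A_col_gt0 : forall y, 0 < \sum_x A x y.
Hypothesis p_01 : forall k, (k <= m)%N -> 0 <= p k <= 1.
Hypothesis p_linear : forall k, (k <= m)%N -> p k = k%:R / m%:R.
Hypothesis G0_edges : size (edges G0) = (m * n0)%N.
Hypothesis G0_deg : forall v : 'I_n0, (0 < deg G0 v)%N.
Hypothesis G0_comm : forall i : 'I_N, exists v : 'I_n0, comm G0 v = i.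

Definition arrivals (t : nat) : finType := ('I_N * m.-tuple 'I_(t + n0) * bool)%type.
Local Notation hist := (forall t, arrivals t).
Local Notation gr := (@graph_at N m n0 G0).

Lemma graph_at_adapted t : adapted t (fun h : hist => gr h t).
Proof.
elim: t => [//|t IH] h h' hh' /=.
by rewrite (IH h h') ?hh'// => s st; apply: hh'; exact: ltnW.
Qed.

Lemma comm_deg_graph_gt0 (h : hist) t i : 0 < comm_deg R (gr h t) i.
Proof.
elim: t i => [|t IH] i /=.
  have [v vi] := G0_comm i.
  rewrite /comm_deg (bigD1 v)//= vi eqxx mul1r ltr_wpDr ?ltr0n ?G0_deg//.
  by apply: sumr_ge0 => u _; rewrite mulr_ge0.
by apply: lt_le_trans (comm_deg_add_ge R (gr h t) i (h t)); rewrite ltr_wpDr// mulr_ge0.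
Qed.

Lemma size_edges_graph (h : hist) t : size (edges (gr h t)) = (m * (t + n0))%N.
Proof.
elim: t => [//|t IH] /=.
by rewrite size_cat !size_map IH size_tuple addSn mulnS addnC.
Qed.

Definition next_law t (h : hist) (a : arrivals t) : R := arrival_law mu A p (gr h t) a.

Lemma next_law_ge0 t (h : hist) (a : arrivals t) : 0 <= next_law h a.
Proof. by apply: arrival_law_ge0 => // i; exact: ltW. Qed.

Lemma next_law_sum1 t (h : hist) : \sum_(a : arrivals t) next_law h a = 1.
Proof. by apply: arrival_law_sum1 => // i; exact: comm_deg_graph_gt0. Qed.

Lemma graph_upd (h : hist) t (a : arrivals t) : gr (upd h a) t = gr h t.
Proof.
exact: (@adapted_upd arrivals _ t (fun h => gr h t) h a (@graph_at_adapted t)).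
Qed.

Lemma mean_step_next t (h : hist) (F : hist -> R) (f : arrivals t -> R) :
  (forall a : arrivals t, F (upd h a) = f a) ->
  mean_step next_law t F h = \sum_(a : arrivals t) arrival_law mu A p (gr h t) a * f a.
Proof. by move=> Ff; apply: eq_bigr => a _; rewrite Ff. Qed.

Section noise.
Variable i : 'I_N.

Definition comm_noise s (h : hist) : R :=
  (acomm (h s : arrival N m (s + n0)) == i)%:R - mu i.

(** The martingale increment of the red proportion of community [i].  The truncation
    at degree [L], decided by the past, keeps it centred and bounds it surely. *)
Definition gain_noise (L : R) s (h : hist) : R :=
  if L <= comm_deg R (gr h s) i then
    (red_gain R (gr h s) i (h s) - drift m mu A (gr h s) i) / comm_deg R (gr h s) i
  else 0.

Lemma comm_noise_adapted s : adapted s.+1 (comm_noise s).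
Proof. by move=> h h' hh'; rewrite /comm_noise hh'. Qed.

Lemma gain_noise_adapted L s : adapted s.+1 (gain_noise L s).
Proof.
move=> h h' hh'; rewrite /gain_noise hh'// (@graph_at_adapted s h h')// => r rs.
by apply: hh'; exact: ltnW.
Qed.

Lemma comm_noise_center s h : mean_step next_law s (comm_noise s) h = 0.
Proof.
rewrite (@mean_step_next s h _ (fun a => (acomm a == i)%:R - mu i)); last first.
  by move=> a; rewrite /comm_noise dfwith_in.
under eq_bigr do rewrite mulrBr.
rewrite sumrB newcomer_comm_mean//; last by move=> j; exact: comm_deg_graph_gt0.
have -> : \sum_(a : arrivals s) arrival_law mu A p (gr h s) a * mu i
    = (\sum_(a : arrivals s) next_law h a) * mu i by rewrite mulr_suml.
by rewrite (next_law_sum1 s h) mul1r subrr.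
Qed.

Lemma gain_noise_center L s h : mean_step next_law s (gain_noise L s) h = 0.
Proof.
rewrite (@mean_step_next s h _ (fun a => if L <= comm_deg R (gr h s) i then
    (red_gain R (gr h s) i a - drift m mu A (gr h s) i) / comm_deg R (gr h s) i
  else 0)); last first.
  by move=> a; rewrite /gain_noise dfwith_in graph_upd.
case: (L <= comm_deg R (gr h s) i); last by rewrite big1// => a _; rewrite mulr0.
under eq_bigr do rewrite mulrA mulrBr.
rewrite -mulr_suml sumrB red_gain_mean//; last by move=> j; exact: comm_deg_graph_gt0.
have -> : \sum_(a : arrivals s) arrival_law mu A p (gr h s) a * drift m mu A (gr h s) i
    = (\sum_(a : arrivals s) next_law h a) * drift m mu A (gr h s) i.
  by rewrite mulr_suml.
by rewrite (next_law_sum1 s h) mul1r subrr mul0r.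
Qed.

Lemma comm_noise_le s h : `|comm_noise s h| ^+ 2 <= 1.
Proof.
have mu1 : mu i <= 1.
  by rewrite -mu_sum1 (bigD1 i)//= lerDl sumr_ge0// => j _; exact: ltW.
have mu0 := mu_gt0 i.
rewrite exprn_ile1// /comm_noise ler_norml.
by case: eqP => _; rewrite ?mulr1n ?mulr0n; apply/andP; split; lra.
Qed.

Lemma gain_noise_le L s h : 0 < L ->
  `|gain_noise L s h| ^+ 2 <= (3 * m%:R / L) ^+ 2.
Proof.
move=> L0; have m0 : 0 <= m%:R :> R by [].
apply: lerXn2r; rewrite ?nnegrE ?divr_ge0 ?mulr_ge0 ?(ltW L0)//.
rewrite /gain_noise; case: ifP => [LD|_]; last first.
  by rewrite normr0 divr_ge0 ?mulr_ge0// ltW.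
have D0 := lt_le_trans L0 LD.
rewrite normrM normfV (gtr0_norm D0).
apply: ler_pM => //; first by rewrite invr_ge0 ltW.
  apply: le_trans (ler_normB _ _) _.
  have := red_gain_le R (gr h s) i (h s).
  have := @drift_le R N m mu A (fun j => ltW (mu_gt0 j)) mu_sum1 A_ge0 A_col_gt0
     _ (gr h s) (fun j => comm_deg_graph_gt0 h s j) i.
  lra.
by rewrite lef_pV2 ?posrE.
Qed.

Lemma comm_deg_graph_ge (h : hist) t :
  m%:R * \sum_(0 <= s < t) (acomm (h s : arrival N m (s + n0)) == i)%:R
  <= comm_deg R (gr h t) i.
Proof.
elim: t => [|t IH]; first by rewrite big_geq// mulr0 comm_deg_ge0.
rewrite big_nat_recr//= mulrDr.
apply: le_trans (comm_deg_add_ge R (gr h t) i (h t)); exact: lerD.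
Qed.

Lemma comm_deg_graph_le (h : hist) t : comm_deg R (gr h t) i <= 2 * m%:R * (t + n0)%:R.
Proof.
by apply: le_trans (comm_deg_le_edges _ _ _) _; rewrite size_edges_graph natrM mulrA.
Qed.

Lemma comm_deg_graph_mono (h : hist) s t : (s <= t)%N ->
  comm_deg R (gr h s) i <= comm_deg R (gr h t) i.
Proof.
move=> /subnKC <-; elim: (t - s)%N => [|n IH]; first by rewrite addn0.
rewrite addnS; apply: le_trans IH _ => /=.
by apply: le_trans (comm_deg_add_ge R (gr h _) i (h _)); rewrite lerDl mulr_ge0.
Qed.

(** Half of the mean degree brought to community [i] by its own newcomers before
    time [k ^ 5]. *)
Definition deg_floor k : R := m%:R * mu i / 2 * (k ^ 5)%:R.

(** The first alternative loses the linear growth of the degree of community [i],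
    the second one the summability of the noise over the blocks. *)
Definition irregular k (h : hist) : Prop :=
  mu i / 2 * (k ^ 5)%:R < `|\sum_(0 <= s < k ^ 5) comm_noise s h| \/
  (k%:R ^+ 2)^-1 < `|\sum_(k ^ 5 <= s < k.+1 ^ 5) gain_noise (deg_floor k) s h|.

Lemma deg_floor_gt0 k : (0 < k)%N -> 0 < deg_floor k.
Proof.
move=> k0; rewrite /deg_floor mulr_gt0 ?divr_gt0 ?mulr_gt0// ltr0n//.
by rewrite expn_gt0 k0.
Qed.

(** Each newcomer of community [i] brings degree [m] to it, and the first half of
    regularity says that at least half of their expected number have come. *)
Lemma comm_deg_graph_floor (h : hist) k t : ~ irregular k h -> (k ^ 5 <= t)%N ->
  deg_floor k <= comm_deg R (gr h t) i.
Proof.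
move=> /not_orP[/negP]; rewrite -leNgt => H _ kt.
apply: le_trans (comm_deg_graph_mono h kt); apply: le_trans (comm_deg_graph_ge h _).
rewrite /deg_floor -!mulrA ler_wpM2l//.
move: H; rewrite /comm_noise sumrB big_const_nat subn0 iter_addr_0 ler_norml.
move=> /andP[+ _]; rewrite -[mu i *+ _]mulr_natr; lra.
Qed.

Section bound.
Context d (T : measurableType d) (P : probability T R) (X : forall t, T -> arrivals t).
Hypothesis X_measurable : forall t (a : arrivals t), measurable [set x | X t x = a].
Hypothesis X_law : forall (h : hist) t (a : arrivals t),
  P (same_past X h t `&` [set x | X t x = a]) =
  (P (same_past X h t) * (next_law h a)%:E)%E.

Lemma measurable_noise (xi : nat -> hist -> R) a b (eps : R) :
  (forall s, adapted s.+1 (xi s)) ->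
  measurable [set x | (eps < `|\sum_(a <= s < b) xi s (fun s => X s x)|)%R].
Proof.
move=> xa; apply: (@measurable_adapted arrivals _ T X X_measurable b
  (fun h => eps < `|\sum_(a <= s < b) xi s h|)).
by move=> h h' hh'; rewrite (@adapted_sum _ _ _ xa a b h h' hh').
Qed.

Lemma irregular_setE k : [set x | irregular k (fun s => X s x)]
  = [set x | mu i / 2 * (k ^ 5)%:R
             < `|\sum_(0 <= s < k ^ 5) comm_noise s (fun s => X s x)|]
    `|` [set x | (k%:R ^+ 2)^-1 < `|\sum_(k ^ 5 <= s < k.+1 ^ 5)
                   gain_noise (deg_floor k) s (fun s => X s x)|].
Proof. by []. Qed.

Lemma measurable_irregular k : measurable [set x | irregular k (fun s => X s x)].
Proof.
rewrite irregular_setE; apply: measurableU; apply: measurable_noise.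
  exact: comm_noise_adapted.
exact: gain_noise_adapted.
Qed.

(** Chebyshev for the [k ^ 5] bounded increments of the first sum, and for the at
    most [31 k ^ 4] increments of the second, each of size [O(k ^ -5)]. *)
Lemma irregular_prob_le (h0 : hist) : exists2 C : R, 0 <= C & forall k, (0 < k)%N ->
  (P [set x | irregular k (fun s => X s x)] <= (C * (k%:R ^+ 2)^-1)%:E)%E.
Proof.
(* 1120 is 4 from the first alternative plus 36 * 31 from the second. *)
exists (1120 / mu i ^+ 2) => [|k k0].
  exact: divr_ge0 (ler0n R 1120) (sqr_ge0 (mu i)).
have kR : 0 < k%:R :> R by rewrite ltr0n.
have k1 : 1 <= k%:R :> R by rewrite ler1n.
have mu0 := mu_gt0 i; have m0 : 0 < m%:R :> R by rewrite ltr0n.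
have k5 : 0 < (k ^ 5)%:R :> R by rewrite ltr0n expn_gt0 k0.
have B1 := martingale_chebyshev next_law_ge0 next_law_sum1 X_measurable X_law h0
  comm_noise_adapted comm_noise_center comm_noise_le (leq0n (k ^ 5))
  (mulr_gt0 (divr_gt0 mu0 (ltr0Sn _ 1)) k5).
have kk : (k ^ 5 <= k.+1 ^ 5)%N by rewrite leq_exp2r.
have e0 : 0 < (k%:R ^+ 2)^-1 :> R by rewrite invr_gt0 exprn_gt0.
have B2 := martingale_chebyshev next_law_ge0 next_law_sum1 X_measurable X_law h0
  (gain_noise_adapted (deg_floor k)) (gain_noise_center (deg_floor k))
  (fun s h => gain_noise_le s h (deg_floor_gt0 k0)) kk e0.
rewrite irregular_setE; apply: le_trans (measureU2 _ _ _) _.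
- exact/measurable_noise/comm_noise_adapted.
- exact/measurable_noise/gain_noise_adapted.
apply: le_trans (leeD B1 B2) _; rewrite -EFinD lee_fin.
rewrite !big_const_nat !iter_addr_0 subn0.
rewrite -[_ *+ (_ - _)]mulr_natr.
have L31 := @block_le R k k0; rewrite /deg_floor !natrX in L31 *.
have -> : (3 * m%:R / (m%:R * mu i / 2 * k%:R ^+ 5)) ^+ 2
    = 36 / mu i ^+ 2 / k%:R ^+ 10.
  by field; rewrite !lt0r_neq0.
set l := (_ - _)%:R in L31 *.
apply: (@le_trans _ _ (k%:R ^+ 5 / (mu i / 2 * k%:R ^+ 5) ^+ 2 +
  36 / mu i ^+ 2 / k%:R ^+ 10 * (31 * k%:R ^+ 4) / (k%:R ^+ 2)^-1 ^+ 2)).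
  rewrite lerD2l ler_wpM2r ?invr_ge0 ?sqr_ge0//.
  by rewrite ler_wpM2l// !mulr_ge0 ?invr_ge0 ?exprn_ge0// ltW.
have -> : k%:R ^+ 5 / (mu i / 2 * k%:R ^+ 5) ^+ 2
    = 4 / mu i ^+ 2 * (k%:R ^+ 5)^-1 by field; rewrite !lt0r_neq0.
have -> : 36 / mu i ^+ 2 / k%:R ^+ 10 * (31 * k%:R ^+ 4) / (k%:R ^+ 2)^-1 ^+ 2
    = 1116 / mu i ^+ 2 * (k%:R ^+ 2)^-1 by field; rewrite !lt0r_neq0.
have -> : 1120 / mu i ^+ 2 * (k%:R ^+ 2)^-1
  = 4 / mu i ^+ 2 * (k%:R ^+ 2)^-1 + 1116 / mu i ^+ 2 * (k%:R ^+ 2)^-1 :> R by ring.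
rewrite lerD2r ler_wpM2l ?divr_ge0 ?sqr_ge0// lef_pV2 ?posrE ?exprn_gt0//.
by apply: ler_weXn2l.
Qed.

Lemma ae_eventually_regular :
  {ae P, forall x, exists K, forall k, (K <= k)%N -> ~ irregular k (fun s => X s x)}.
Proof.
have [h0|nh] := pselect (exists h : hist, True); last first.
  by apply/nearW => x; exfalso; apply: nh; exists (fun s => X s x).
have {h0}[h0 _] := h0.
pose F k := [set x | irregular k.+1 (fun s => X s x)].
have mF k : measurable (F k) by exact: measurable_irregular.
have [C C0 FC] := irregular_prob_le h0.
have F0 : P (lim_sup_set F) = 0%E.
  apply: lim_sup_set_cvg0 => //.
  apply: (@le_lt_trans _ _ (C * 2)%:E); last exact: ltry.
  apply: lime_le; first exact: is_cvg_nneseries.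
  apply: nearW => n.
  apply: (@le_trans _ _ (\sum_(0 <= k < n) (C * (k.+1%:R ^+ 2)^-1)%:E)%E).
    by apply: lee_sum => k _; exact: FC.
  rewrite sumEFin lee_fin -mulr_sumr; apply: ler_wpM2l => //.
  by rewrite big_mkord; exact: sum_inv_sqr_le.
exists (lim_sup_set F); split => //.
  by apply: bigcap_measurable => // n _; exact: bigcup_measurable.
move=> x /= H n _; apply: contrapT => nF; apply: H; exists n.+1 => -[//|k] nk bk.
by apply: nF; exists k.
Qed.
End bound.
End noise.

Section block_recursion.
Variable h : hist.
Local Notation Z t j := (red_prop R (gr h t) j).
Local Notation D t j := (comm_deg R (gr h t) j).

(** The weight of [Z s j] in the averaging performed by [Z _ i] at time [s]. *)
Definition step_weight i s j : R := m%:R * mu i / D s i * attach_comm A (gr h s) i j.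

Lemma red_prop_step i s L : 0 < L -> L <= D s i ->
  `|Z s.+1 i - Z s i| <= 2 * m%:R / L.
Proof.
move=> L0 LD; rewrite /= red_prop_add; last by move=> j; exact: comm_deg_graph_gt0.
have LD' : L <= D s.+1 i := le_trans LD (comm_deg_graph_mono i h (leqnSn s)).
have D'0 := lt_le_trans L0 LD'.
rewrite normrM normfV (gtr0_norm D'0); apply: ler_pM => //.
- by rewrite invr_ge0 ltW.
- exact: red_gain_le.
- by rewrite lef_pV2 ?posrE.
Qed.

(** To first order the increment is [red_gain / D s i], noise plus drift; the error
    comes from dividing by the degree after the step instead of before. *)
Lemma red_prop_increment i s L : 0 < L -> L <= D s i ->
  `|Z s.+1 i - Z s i - gain_noise i L s h
    - \sum_j step_weight i s j * (Z s j - Z s i)|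
  <= 2 * m%:R / L * (2 * m%:R / L).
Proof.
move=> L0 LD; rewrite /gain_noise LD.
have LD' : L <= D s.+1 i := le_trans LD (comm_deg_graph_mono i h (leqnSn s)).
have D0 := lt_le_trans L0 LD; have D'0 := lt_le_trans L0 LD'.
have -> : \sum_j step_weight i s j * (Z s j - Z s i) = drift m mu A (gr h s) i / D s i.
  rewrite /drift mulrAC mulr_sumr; apply: eq_bigr => j _.
  by rewrite /step_weight [RHS]mulrA.
rewrite /= red_prop_add; last by move=> j; exact: comm_deg_graph_gt0.
have DD : D s.+1 i - D s i <= 2 * m%:R by rewrite lerBlDl; exact: comm_deg_add_le.
have DD0 : 0 <= D s.+1 i - D s i by rewrite subr_ge0; exact: comm_deg_graph_mono.
have -> : red_gain R (gr h s) i (h s) / D s.+1 i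
    - (red_gain R (gr h s) i (h s) - drift m mu A (gr h s) i) / D s i
    - drift m mu A (gr h s) i / D s i
    = - (red_gain R (gr h s) i (h s) / D s.+1 i * ((D s.+1 i - D s i) / D s i)).
  by field; rewrite !lt0r_neq0.
rewrite normrN normrM; apply: ler_pM => //.
  rewrite normrM normfV (gtr0_norm D'0); apply: ler_pM => //.
  - by rewrite invr_ge0 ltW.
  - exact: red_gain_le.
  - by rewrite lef_pV2 ?posrE.
rewrite normrM normfV (gtr0_norm D0) (ger0_norm DD0); apply: ler_pM => //.
- by rewrite invr_ge0 ltW.
- by rewrite lef_pV2 ?posrE.
Qed.

Lemma step_weight_ge0 i s j : 0 <= step_weight i s j.
Proof.
rewrite /step_weight mulr_ge0 ?attach_comm_ge0//.
by rewrite divr_ge0 ?comm_deg_ge0// mulr_ge0// ltW.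
Qed.

Lemma step_weight_sum i s L : 0 < L -> L <= D s i ->
  \sum_j step_weight i s j <= m%:R * mu i / L.
Proof.
move=> L0 LD; rewrite -mulr_sumr attach_comm_sum1//; last first.
  by move=> j; exact: comm_deg_graph_gt0.
rewrite mulr1 ler_wpM2l//; first by rewrite mulr_ge0// ltW.
by rewrite lef_pV2 ?posrE// (lt_le_trans L0).
Qed.

Lemma step_weight_ge i j s L H : 0 < L -> L <= D s j ->
  (forall l, D s l <= H) ->
  m%:R * mu i * A j i * L / (H ^+ 2 * \sum_l A l i) <= step_weight i s j.
Proof.
move=> L0 LD DH; rewrite /step_weight /attach_comm.
have D0 := comm_deg_graph_gt0 h s i.
have H0 : 0 < H := lt_le_trans D0 (DH i).
have S0 : 0 < \sum_l A l i * D s l.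
  rewrite -attach_denom attach_denom_gt0// => l; exact: comm_deg_graph_gt0.
have -> : m%:R * mu i / D s i * (A j i * D s j / \sum_l A l i * D s l)
  = m%:R * mu i * A j i * D s j / (D s i * \sum_l A l i * D s l).
  by field; rewrite !lt0r_neq0.
apply: ler_pM.
- by rewrite !mulr_ge0// ltW.
- by rewrite invr_ge0 mulr_ge0 ?sqr_ge0// ltW.
- by apply: ler_wpM2l => //; rewrite !mulr_ge0// ltW.
rewrite lef_pV2 ?posrE ?mulr_gt0// ?exprn_gt0//.
rewrite expr2 -mulrA; apply: ler_pM => //; [exact: ltW|exact: ltW|].
by rewrite mulr_sumr; apply: ler_sum => l _; rewrite mulrC ler_wpM2r.
Qed.

(** The probability-free half of the theorem: from some [K] on all blocks are
    regular, so at the block times [k ^ 5] the red proportions satisfy the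
    hypotheses of the consensus lemma; between two block times they move by
    [O(1 / k)]. *)
Lemma block_cvg : (forall i, exists K, forall k, (K <= k)%N -> ~ irregular i k h) ->
  (exists v, forall i, connect (Gamma A) i v) ->
  exists l : R, forall i, Z t i @[t --> \oo] --> l.
Proof.
move=> /choice[Kf HK] [v v_sink].
(* The successor keeps [k] away from 0 in all the divisions below. *)
pose K := (\max_i Kf i).+1.
have regular i k : (K <= k)%N -> ~ irregular i k h.
  by move=> Kk; apply: HK; apply: leq_trans (ltnW Kk); exact: leq_bigmax.
have [dl dl0 dl_mu] := pos_lower_bound (Q := xpredT) (fun i _ => mu_gt0 i).
have m0 : 0 < m%:R :> R by rewrite ltr0n.
(* One step of block [k] moves a red proportion by at most [b / k ^ 5]. *)
pose b := 4 * m%:R / (m%:R * dl).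
have b0 : 0 <= b by rewrite divr_ge0 ?mulr_ge0// ltW.
have x1 k : (K <= k)%N -> 1 <= k%:R :> R by move=> Kk; rewrite ler1n (leq_trans _ Kk).
have x0p k : (K <= k)%N -> 0 < k%:R :> R by move=> Kk; rewrite ltr0n (leq_trans _ Kk).
have fl i k s : (K <= k)%N -> (k ^ 5 <= s)%N -> deg_floor i k <= D s i.
  by move=> Kk ks; apply: comm_deg_graph_floor ks; exact: regular.
have fl0 i k : (K <= k)%N -> 0 < deg_floor i k.
  by move=> Kk; apply: deg_floor_gt0; exact: leq_trans Kk.
have flb i k : (K <= k)%N -> 2 * m%:R / deg_floor i k <= b / k%:R ^+ 5.
  move=> Kk; have x := x1 k Kk; have x0 := x0p k Kk.
  have y0 : 0 < k%:R ^+ 5 :> R by rewrite exprn_gt0.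
  have mu0 := mu_gt0 i.
  have -> : 2 * m%:R / deg_floor i k = 4 / mu i / k%:R ^+ 5.
    by rewrite /deg_floor natrX; field; rewrite !lt0r_neq0.
  have -> : b / k%:R ^+ 5 = 4 / dl / k%:R ^+ 5.
    by rewrite /b; field; rewrite !lt0r_neq0.
  rewrite ler_wpM2r ?invr_ge0 ?(ltW y0)// ler_wpM2l// lef_pV2 ?posrE//.
  exact: dl_mu.
have mv i k s : (K <= k)%N -> (k ^ 5 <= s)%N -> `|Z s.+1 i - Z s i| <= b / k%:R ^+ 5.
  move=> Kk ks; apply: le_trans (flb i k Kk).
  exact: red_prop_step (fl0 i k Kk) (fl i k s Kk ks).
have len k : (K <= k)%N -> (k.+1 ^ 5 - k ^ 5)%:R <= 31 * k%:R ^+ 4 :> R.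
  by move=> Kk; apply: block_le; exact: leq_trans Kk.
have kk k : (k ^ 5 <= k.+1 ^ 5)%N by rewrite leq_exp2r.
pose w k i j := \sum_(k ^ 5 <= s < k.+1 ^ 5) step_weight i s j.
have lamE i k : (K <= k)%N -> m%:R * mu i / deg_floor i k = 2 / k%:R ^+ 5.
  move=> Kk; have x := x1 k Kk; have x0 := x0p k Kk; have mu0 := mu_gt0 i.
  by rewrite /deg_floor natrX; field; rewrite !lt0r_neq0//.
have wsum i k : (K <= k)%N -> \sum_j w k i j <= 62 / k%:R.
  move=> Kk; have x := x1 k Kk; have x0 := x0p k Kk; rewrite /w exchange_big/=.
  apply: (@le_trans _ _ (\sum_(k ^ 5 <= s < k.+1 ^ 5) (2 / k%:R ^+ 5))).
    rewrite big_nat_cond [leRHS]big_nat_cond; apply: ler_sum => s; rewrite andbT.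
    move=> /andP[ks _]; rewrite -(lamE i k Kk).
    exact: step_weight_sum (fl0 i k Kk) (fl i k s Kk ks).
  rewrite big_const_nat iter_addr_0 -[leLHS]mulr_natr.
  have -> : 62 / k%:R = 2 / k%:R ^+ 5 * (31 * k%:R ^+ 4) :> R.
    by field; rewrite lt0r_neq0//.
  rewrite ler_wpM2l ?len// divr_ge0// exprn_ge0//.
(* An upper bound for all degrees during block [k], divided by [k ^ 5]: the total
   degree is [2 m (s + n0)], and [s <= (2 k) ^ 5]. *)
pose Hc : R := 2 * m%:R * (32 + n0)%:R.
have Hc0 : 0 < Hc by rewrite /Hc mulr_gt0 ?mulr_gt0// ltr0n.
have DH k s l : (K <= k)%N -> (s < k.+1 ^ 5)%N -> D s l <= Hc * k%:R ^+ 5.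
  move=> Kk sk; apply: le_trans (comm_deg_graph_le l h s) _.
  have -> : Hc * k%:R ^+ 5 = 2 * m%:R * ((32 + n0) * k ^ 5)%:R.
    by rewrite natrM natrX mulrA.
  apply: ler_wpM2l; first by rewrite mulr_ge0.
  rewrite ler_nat mulnDl.
  have k0 : (0 < k)%N by exact: leq_trans Kk.
  rewrite leq_add// ?leq_pmulr ?expn_gt0 ?k0//.
  apply: (leq_trans (ltnW sk)); rewrite -[32%N]/(2 ^ 5)%N -expnMn leq_exp2r//.
  by rewrite mul2n -addnn -addn1 leq_add2l.
have [c c0 cP] : exists2 c, 0 < c & forall ij : 'I_N * 'I_N, 0 < A ij.2 ij.1 ->
    c <= m%:R * mu ij.1 * A ij.2 ij.1 * (m%:R * mu ij.2 / 2)
         / (Hc ^+ 2 * \sum_l A l ij.1).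
  apply: pos_lower_bound => ij Aij.
  by rewrite divr_gt0 ?mulr_gt0 ?divr_gt0 ?mulr_gt0 ?exprn_gt0.
have wge i j k : (K <= k)%N -> Gamma A i j -> c / k%:R <= w k i j.
  move=> Kk; rewrite /Gamma => Aij; have x0 := x0p k Kk.
  apply: (@le_trans _ _ (\sum_(k ^ 5 <= s < k.+1 ^ 5) (c / k%:R ^+ 5))).
    rewrite big_const_nat iter_addr_0 -[leRHS]mulr_natr.
    have -> : c / k%:R = c / k%:R ^+ 5 * k%:R ^+ 4 :> R.
      by field; rewrite lt0r_neq0//.
    rewrite ler_wpM2l ?block_ge// divr_ge0 ?exprn_ge0// ltW//.
  rewrite /w big_nat_cond [leRHS]big_nat_cond; apply: ler_sum => s; rewrite andbT.
  move=> /andP[ks sk].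
  have DHs l := DH k s l Kk sk.
  apply: le_trans (step_weight_ge i (fl0 j k Kk) (fl j k s Kk ks) DHs).
  have -> : m%:R * mu i * A j i * deg_floor j k
      / ((Hc * k%:R ^+ 5) ^+ 2 * \sum_l A l i)
    = m%:R * mu i * A j i * (m%:R * mu j / 2) / (Hc ^+ 2 * \sum_l A l i)
      / k%:R ^+ 5.
    rewrite /deg_floor natrX; field.
    by rewrite !lt0r_neq0//.
  by rewrite ler_wpM2r ?invr_ge0 ?exprn_ge0//; exact: (cP (i, j)).
(* Local errors, noise and freezing in [block_average], with at most [31 k ^ 4] steps
   in block [k]. *)
pose E := 31 * (b * b) + 1 + 31 * (2 * (2 * (31 * b))).
have E0 : 0 <= E by rewrite /E; have := mulr_ge0 b0 b0; lra.
have zE k i : (K <= k)%N ->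
    `|Z (k.+1 ^ 5)%N i - Z (k ^ 5)%N i
      - \sum_j w k i j * (Z (k ^ 5)%N j - Z (k ^ 5)%N i)| <= E / k%:R ^+ 2.
  move=> Kk; have x := x1 k Kk; have x0 := x0p k Kk.
  have b5 : 0 <= b / k%:R ^+ 5 by rewrite divr_ge0 ?exprn_ge0.
  have av := @block_average R N (fun t j => Z t j) (step_weight i)
    (fun s => gain_noise i (deg_floor i k) s h) i (k ^ 5) (k.+1 ^ 5)
    (b / k%:R ^+ 5 * (b / k%:R ^+ 5)) (b / k%:R ^+ 5) (2 / k%:R ^+ 5)
    ((k%:R ^+ 2)^-1) (kk k) b5.
  apply: le_trans (av _ _ _ _ _) _.
  - move=> s /andP[ks _].
    apply: le_trans (red_prop_increment (fl0 i k Kk) (fl i k s Kk ks)) _.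
    have f0 : 0 <= 2 * m%:R / deg_floor i k.
      by rewrite divr_ge0 ?mulr_ge0// ltW ?fl0.
    by apply: ler_pM => //; exact: flb.
  - by move=> s j /andP[ks _]; exact: mv.
  - by move=> s j _; exact: step_weight_ge0.
  - move=> s /andP[ks _]; rewrite -(lamE i k Kk).
    exact: step_weight_sum (fl0 i k Kk) (fl i k s Kk ks).
  - by have /not_orP[_ /negP] := regular i k Kk; rewrite -leNgt.
  have n31 := len k Kk; set n := (_ - _)%:R in n31 *.
  have n0' : 0 <= n by [].
  have y0 : 0 < k%:R ^+ 2 :> R by rewrite exprn_gt0.
  have -> : E / k%:R ^+ 2 = 31 * (b * b) / k%:R ^+ 2 + (k%:R ^+ 2)^-1
      + 31 * k%:R ^+ 4 * (2 / k%:R ^+ 5 * (2 * (31 * k%:R ^+ 4 * (b / k%:R ^+ 5)))).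
    by rewrite /E; field; rewrite lt0r_neq0.
  apply: lerD; first apply: lerD => //.
    apply: (@le_trans _ _ (31 * k%:R ^+ 4 * (b / k%:R ^+ 5 * (b / k%:R ^+ 5)))).
      by apply: ler_wpM2r => //; rewrite mulr_ge0.
    have -> : 31 * k%:R ^+ 4 * (b / k%:R ^+ 5 * (b / k%:R ^+ 5))
      = 31 * (b * b) / k%:R ^+ 2 / k%:R ^+ 4 by field; rewrite lt0r_neq0.
    rewrite ler_pdivrMr ?exprn_gt0// ler_peMr ?exprn_ege1//.
    by apply: divr_ge0 (ltW y0); apply: mulr_ge0 => //; exact: mulr_ge0.
  have k5 : 0 <= 2 / k%:R ^+ 5 :> R by rewrite divr_ge0 ?exprn_ge0.
  apply: ler_pM => //.
    by apply: mulr_ge0 => //; apply: mulr_ge0 => //; exact: mulr_ge0.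
  apply: ler_wpM2l => //; apply: ler_wpM2l => //; exact: ler_wpM2r.
have Z1 k i : `|Z (k ^ 5)%N i| <= 1.
  by have /andP[z0 z1] := red_prop_itv R (gr h (k ^ 5)) i; rewrite ger0_norm.
have C62 : 0 <= 62 :> R by [].
have [l lP] := consensus_cvg C62 c0 (ltn0Sn (\max_i Kf i)) E0
  (fun k i j _ => sumr_ge0 _ (fun s _ => step_weight_ge0 i s j))
  (fun k i Kk => wsum i k Kk) (fun k i j Kk => wge i j k Kk) zE Z1 v_sink.
exists l => i; apply/cvgrPdist_le => e e0.
have e2 : 0 < e / 2 by rewrite divr_gt0.
have /cvgrPdist_le /(_ _ e2) [k1 _ k1P] := lP i.
have /cvgrPdist_le /(_ _ e2) [k2 _ k2P] := @cvg_div_nat R (31 * b).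
pose k3 := maxn K (maxn k1 k2).
exists (k3 ^ 5)%N => // t /= /exists_block[k k3k /andP[kt tk]].
have Kk : (K <= k)%N by apply: leq_trans k3k; exact: leq_maxl.
have k1k : (k1 <= k)%N by apply: leq_trans k3k; rewrite leq_max leq_maxl orbT.
have k2k : (k2 <= k)%N by apply: leq_trans k3k; rewrite leq_max leq_maxr orbT.
have x0 := x0p k Kk.
have b5 : 0 <= b / k%:R ^+ 5 by rewrite divr_ge0 ?exprn_ge0.
have d1 := k1P k k1k; have := k2P k k2k.
rewrite /= sub0r normrN => /(le_trans (ler_norm _)) d2.
have d3 : `|Z t i - Z (k ^ 5)%N i| <= 31 * b / k%:R.
  apply: (@le_trans _ _ ((t - k ^ 5)%:R * (b / k%:R ^+ 5))).
    apply: (telescope_norm_le (z := fun t => Z t i)) => // s /andP[ks _].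
    exact: mv.
  have -> : 31 * b / k%:R = 31 * k%:R ^+ 4 * (b / k%:R ^+ 5).
    by field; rewrite lt0r_neq0//.
  apply: ler_wpM2r => //; apply: le_trans (len k Kk).
  by rewrite ler_nat; apply/leq_sub2r/ltnW.
have -> : l - Z t i = (l - Z (k ^ 5)%N i) - (Z t i - Z (k ^ 5)%N i) by ring.
apply: le_trans (ler_normB _ _) _; rewrite [e]splitr; apply: lerD => //.
exact: le_trans d2.
Qed.
End block_recursion.
End process.

(** * The law of the process and the theorem *)

Lemma measurable_fun_adapted (S : nat -> finType) d (T : measurableType d)
    (X : forall t, T -> S t) d' (V : measurableType d') t (F : (forall t, S t) -> V) :
  (forall t (a : S t), measurable [set x | X t x = a]) -> adapted t F ->
  measurable_fun setT (fun x => F (fun s => X s x)).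
Proof.
move=> mX aF _ U mU; rewrite setTI.
apply: (@measurable_adapted S d T X mX t (fun h => U (F h))).
by move=> h h' hh'; rewrite (aF h h').
Qed.

(** The chain rule for community, neighbours and colour; the blue case is the
    complement of the red one. *)
Lemma pa_law (d : measure_display) (T : measurableType d) (R : realType)
    (P : probability T R) (N m n0 : nat) (mu : 'I_N -> R) (A : 'M[R]_N)
    (p : nat -> R) (G0 : cgraph N n0) (X : forall t, T -> arrival N m (t + n0)) :
  pa_process P mu A p G0 X ->
  forall (h : history N m n0) t (a : arrival N m (t + n0)),
  P (past X h t `&` [set x | X t x = a])
  = (P (past X h t) * (arrival_law mu A p (graph_at G0 h t) a)%:E)%E.
Proof.
move=> [mX pc pn pt] h t [[c w] b].
have mX' : forall t (a : arrivals N m n0 t), measurable [set x | X t x = a] by [].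
have mpast : measurable (past X h t).
  exact: (@measurable_same_past (arrivals N m n0) d T X mX').
have mev (Q : arrival N m (t + n0) -> Prop) : measurable [set x | Q (X t x)].
  apply: (@measurable_adapted (arrivals N m n0) d T X mX' t.+1 (fun h => Q (h t))).
  by move=> h1 h2 h12; rewrite h12.
set E := past X h t `&` [set x | acomm (X t x) = c] `&` [set x | anbrs (X t x) = w].
have mE : measurable E.
  apply: measurableI; last exact: (mev (fun a => anbrs a = w)).
  by apply: measurableI => //; exact: (mev (fun a => acomm a = c)).
have PE : P E = (P (past X h t) * (mu c
    * \prod_(j < m) attach_prob A (graph_at G0 h t) c (tnth w j))%:E)%E.
  by rewrite /E pn pc EFinM muleA.
have Pr : P (E `&` [set x | ared (X t x)])
    = (P E * (p (red_count (graph_at G0 h t) w))%:E)%E by exact: pt.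
have sE : past X h t `&` [set x | X t x = (c, w, b)]
    = E `&` [set x | ared (X t x) = b].
  apply/seteqP; split => x /=; first by move=> [px Xa]; rewrite /E /= Xa.
  move=> [[[px ec] ew] eb]; split => //; rewrite -ec -ew -eb.
  by case: (X t x) => [[? ?] ?].
rewrite sE /arrival_law /acomm /anbrs /ared/=.
case: b sE => _; first by rewrite Pr PE -muleA -EFinM.
have mr : measurable [set x | ared (X t x)] by exact: (mev (fun a => ared a)).
have -> : E `&` [set x | (X t x).2 = false] = E `\` (E `&` [set x | ared (X t x)]).
  apply/seteqP; split => x /=; first by move=> [Ex r]; split => // -[_];
    rewrite /ared r.
  by move=> [Ex H]; split => //; apply/negbTE/negP => r; apply: H.
rewrite measureD//; [|exact: measurableI|by rewrite ltey_eq fin_num_measure].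
rewrite setIA setIid [X in (_ - X)%E]Pr [X in (X - _)%E]PE PE.
have : P (past X h t) \is a fin_num by rewrite fin_num_measure.
move=> /fineK <-; rewrite -!EFinM -EFinB; congr (_%:E); ring.
Qed.

Theorem theorem3p10 (R : realType) (N m n0 : nat) (hm : (1 <= m)%N)
    (mu : 'I_N -> R)
    (mu_gt0 : forall i, 0 < mu i) (mu_sum1 : \sum_(i < N) mu i = 1)
    (A : 'M[R]_N)
    (A_ge0 : forall x y, 0 <= A x y)
    (A_col_gt0 : forall y, 0 < \sum_(x < N) A x y)
    (p : nat -> R)
    (p_01 : forall k, (k <= m)%N -> 0 <= p k <= 1)
    (G0 : cgraph N n0)
    (G0_edges : size (edges G0) = (m * n0)%N)
    (G0_deg : forall v : 'I_n0, (0 < deg G0 v)%N)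
    (G0_comm : forall i : 'I_N, exists v : 'I_n0, comm G0 v = i)
    (d : measure_display) (T : measurableType d) (P : probability T R)
    (X : forall t : nat, T -> arrival N m (t + n0))
    (X_process : pa_process P mu A p G0 X)
    (Gamma_confluent : forall i j : 'I_N, exists h : 'I_N,
        connect (Gamma A) i h /\ connect (Gamma A) j h)
    (p_linear : forall k, (k <= m)%N -> p k = k%:R / m%:R) :
  exists M : {RV P >-> R},
    {ae P, forall x, forall i : 'I_N,
      red_prop R (graph_at G0 (fun s => X s x) t) i @[t --> \oo] --> M x}.
Proof.
have [i0 _] : exists i0 : 'I_N, True.
  apply: contrapT => noI; move: mu_sum1; rewrite big1.
    by move=> /eqP; rewrite eq_sym oner_eq0.
  by move=> i _; exfalso; apply: noI; exists i.
have mX : forall t (a : arrivals N m n0 t), measurable [set x | X t x = a].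
  exact: pa_measurable X_process.
pose Z (i : 'I_N) t (x : T) := red_prop R (graph_at G0 (fun s => X s x) t) i.
have mZ t : measurable_fun setT (Z i0 t).
  apply: (@measurable_fun_adapted (arrivals N m n0) d T X _ R t
    (fun h => red_prop R (graph_at G0 h t) i0)) => //.
  by move=> h h' hh'; rewrite (@graph_at_adapted N m n0 G0 t h h').
(* The upper limit is measurable everywhere and agrees with the limit where the
   latter exists. *)
pose L x := limn_sup (fun t => Z i0 t x).
have mL : measurable_fun setT L.
  apply: (@measurable_realfun.measurable_fun_limn_sup _ _ R setT (Z i0)) => // x _.
    exists 1 => _ [t _ <-].
    by have /andP[] := red_prop_itv R (graph_at G0 (fun s => X s x) t) i0.
  exists 0 => _ [t _ <-].
  by have /andP[] := red_prop_itv R (graph_at G0 (fun s => X s x) t) i0.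
pose M : {RV P >-> R} := HB.pack L (isMeasurableFun.Build d _ T R L mL).
exists M.
have [v v_sink] := @confluent_sink _ (Gamma A) (enum 'I_N) i0 Gamma_confluent.
have good : {ae P, forall x, forall i, exists K, forall k, (K <= k)%N ->
    ~ irregular mu A G0 i k (fun s => X s x)}.
  apply: filter_forall => i.
  apply: (ae_eventually_regular hm mu_gt0 mu_sum1 A_ge0 A_col_gt0 p_01 p_linear
    G0_deg G0_comm i mX).
  exact: pa_law X_process.
apply: filterS good => x good i.
have [l lP] := block_cvg hm mu_gt0 A_ge0 A_col_gt0 G0_edges G0_deg G0_comm
  good (ex_intro _ v (fun i => v_sink i (mem_enum _ i))).
suff -> : M x = l by exact: lP.
rewrite /M/= /L cvg_limn_supE; last by apply/cvg_ex; exists l; exact: lP.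
exact/cvg_lim/lP.
Qed.
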